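(* Consider the LQG ISO problem $$\min\ \mathbb E\sum_{t=0}^{T-1}\sum_{i=1}^{M}\big[X_i^{\top}(t)Q_iX_i(t)+U_i^{\top}(t)R_iU_i(t)\big]\qquad (P)$$ subject to $X_i(t+1)=A_iX_i(t)+B_iU_i(t)+N_i(t)$ for $1\le i\le M$ and the energy balance constraint $\sum_{i=1}^{M}U_i(t)=0$ for $t=0,\dots,T-1$, over all control processes $U(t)=(U_1(t),\dots,U_M(t))$ adapted to $\mathcal F_t$, under the conditions given in the context. Consider the following bid-price iteration scheme. At each time $s=0,1,\dots,T-1$ in turn, given the current states $X_i(s)$, start from an arbitrary vector of prices $(\lambda_s^0(t))_{s\le t\le T-1}\in\mathbb R^{T-s}$. For each $k\ge0$, each agent $i$ bids the optimal open-loop sequence $(u_{i,s}^k(t))_{s\le t\le T-1}$ of the deterministic problem $$\min\ \sum_{t=s}^{T-1}\big[x_i^{\top}(t)Q_ix_i(t)+u_i(t)^{\top}R_iu_i(t)+\lambda_s^k(t)u_i(t)\big]$$ subject to $x_i(t+1)=A_ix_i(t)+B_iu_i(t)$ for $s\le t\le T-1$, with initial condition $x_i(s)=X_i(s)$; and the ISO updates the prices by $$\lambda_s^{k+1}(t)=\lambda_s^k(t)+\alpha^k\sum_{i=1}^{M}u_{i,s}^k(t),\qquad s\le t\le T-1,$$ where $\alpha^k>0$, $\lim_{k}\alpha^k=0$ and $\sum_{k=0}^{\infty}\alpha^k=+\infty$. The iterations in $k$ are continued to convergence; let $u_{i,s}^\star(t)=\lim_{k\to\infty}u_{i,s}^k(t)$.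 At time $s$ each agent $i$ applies $U_i(s)=u_{i,s}^\star(s)$, after which the system moves to time $s+1$ and the procedure is repeated. Then this scheme achieves the optimal social welfare: the resulting control process is feasible for $(P)$ and its expected cost equals the minimum value of $(P)$.
   Context: There are $M$ agents. Agent $i$ has a finite-dimensional state $X_i(t)$ and scalar action $U_i(t)$ (electricity consumed from the grid, negative if supplied). $A_i,B_i,Q_i,R_i$ are matrices of compatible dimensions, with $Q_i\ge0$ (positive semidefinite, symmetric) and $R_i>0$. Initial conditions are Gaussian, $X_i(0)\sim N(0,\Sigma_{i,0})$, noises are Gaussian, $N_i(t)\sim N(0,P_{i,t})$, and all of these, over all $i$ and $t$, are independent. $\mathcal F_t$ is the $\sigma$-algebra generated by all initial conditions $X_1(0),\dots,X_M(0)$ and all noises $N_i(r)$, $1\le i\le M$, $0\le r\le t-1$. Social welfare is the negative of the expected total cost in $(P)$. Agents do not know the number $M$ of agents, nor the system matrices, noise laws, states or noise realizations of the other agents. *)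

(* Defs.v *)
From HB Require Import structures.
From mathcomp Require Import all_boot all_order all_algebra.
From mathcomp Require Import all_classical all_reals all_analysis.
Set Implicit Arguments.
Unset Strict Implicit.
Unset Printing Implicit Defensive.
Import Order.TTheory GRing.Theory Num.Theory.
Import numFieldNormedType.Exports.
Local Open Scope classical_set_scope.
Local Open Scope ring_scope.

Definition quad (R : realType) (n : nat) (Q : 'M[R]_n) (x : 'cV[R]_n) : R :=
  (x^T *m Q *m x) 0 0.

Definition psd (R : realType) (n : nat) (Q : 'M[R]_n) : Prop :=
  Q^T = Q /\ forall x : 'cV[R]_n, 0 <= quad Q x.

(* The actions are scalar, so the input matrices B_i are columns and the
   1 x 1 weights R_i are elements of R. *)
Record lqg_system (R : realType) (M : nat) := LQGSystem {
  sdim : 'I_M -> nat ;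
  matA : forall i, 'M[R]_(sdim i) ;
  matB : forall i, 'cV[R]_(sdim i) ;
  matQ : forall i, 'M[R]_(sdim i) ;
  wgtR : 'I_M -> R }.

Section system.
Context (R : realType) (M : nat) (G : lqg_system R M).

Definition step (i : 'I_M) (x : 'cV[R]_(sdim G i)) (u : R) : 'cV[R]_(sdim G i) :=
  matA G i *m x + u *: matB G i.

Definition stage_cost (i : 'I_M) (x : 'cV[R]_(sdim G i)) (u : R) : R :=
  quad (matQ G i) x + wgtR G i * u ^+ 2.

(* In the deterministic problems, a state or action sequence over the window
   s, ..., T - 1 is a function on nat of which only the values at times of the
   window (and T, for the state) matter. *)
Definition open_loop (i : 'I_M) (s T : nat) (x0 : 'cV[R]_(sdim G i))
    (x : nat -> 'cV[R]_(sdim G i)) (u : nat -> R) : Prop :=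
  x s = x0 /\ forall t, (s <= t < T)%N -> x t.+1 = step (x t) (u t).

Definition agent_cost (i : 'I_M) (s T : nat) (price : nat -> R)
    (x : nat -> 'cV[R]_(sdim G i)) (u : nat -> R) : R :=
  \sum_(s <= t < T) (stage_cost (x t) (u t) + price t * u t).

Definition optimal_bid (i : 'I_M) (s T : nat) (x0 : 'cV[R]_(sdim G i))
    (price : nat -> R) (u : nat -> R) : Prop :=
  exists x, open_loop s T x0 x u /\
    forall x' u', open_loop s T x0 x' u' ->
      agent_cost s T price x u <= agent_cost s T price x' u'.

Definition price_iteration (s T : nat) (x0 : forall i, 'cV[R]_(sdim G i))
    (alpha : nat -> R) (lam0 : nat -> R)
    (lam : nat -> nat -> R) (u : nat -> 'I_M -> nat -> R) : Prop :=
  [/\ forall t, (s <= t < T)%N -> lam 0%N t = lam0 t,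
      forall k i, optimal_bid s T (x0 i) (lam k) (u k i) &
      forall k t, (s <= t < T)%N ->
        lam k.+1 t = lam k t + alpha k * \sum_(i < M) u k i t].

End system.

Definition step_sizes (R : realType) (alpha : nat -> R) : Prop :=
  [/\ forall k, 0 < alpha k,
      alpha k @[k --> \oo] --> (0 : R) &
      (\sum_(0 <= k <oo) (alpha k)%:E = +oo)%E].

Section probability.
Context (R : realType) (d : measure_display) (Omega : measurableType d).
Variable P : probability Omega R.

(* The law N(0, v) on the line.  The point mass at v = 0 has to be singled out,
   since [normal_prob 0 0] is the uniform law on [0, 1]. *)
Definition normal_law (v : R) (B : set R) : \bar R :=
  if v == 0 then \d_(0 : R) B else normal_prob 0 (Num.sqrt v) B.

(* V ~ N(0, S) with S possibly singular: every linear functional a^T V has law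
   N(0, a^T S a). *)
Definition gaussian_vector (n : nat) (S : 'M[R]_n) (V : Omega -> 'cV[R]_n) :
    Prop :=
  [/\ psd S,
      forall j, measurable_fun [set: Omega] (fun w => V w j 0) &
      forall (a : 'cV[R]_n) (B : set R), measurable B ->
        P ((fun w => (a^T *m V w) 0 0) @^-1` B) = normal_law (quad S a) B].

Definition sigma_vec (n : nat) (V : Omega -> 'cV[R]_n) : set (set Omega) :=
  g_sigma_preimage (fun (j : 'I_n) (w : Omega) => V w j 0).

Definition mutually_independent (I : eqType) (F : I -> set (set Omega)) :
    Prop :=
  forall (s : seq I) (E : I -> set Omega), uniq s ->
    (forall i, i \in s -> F i (E i)) ->
    P (\bigcap_(i in [set` s]) E i) = (\big[*%E/1%E]_(i <- s) P (E i))%E.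

Section agents.
Context (M : nat) (G : lqg_system R M) (T : nat).
Variables (X0 : forall i : 'I_M, Omega -> 'cV[R]_(sdim G i))
          (N : forall i : 'I_M, nat -> Omega -> 'cV[R]_(sdim G i)).

(* The index [inl i] stands for X_i(0), and [inr (i, t)] for N_i(t). *)
Definition primitive_sigma (j : 'I_M + 'I_M * 'I_T) : set (set Omega) :=
  match j with
  | inl i => sigma_vec (X0 i)
  | inr (i, t) => sigma_vec (N i t)
  end.

Definition filtration (t : nat) : set (set Omega) :=
  <<s (\bigcup_(i in [set: 'I_M]) sigma_vec (X0 i)) `|`
      (\bigcup_(i in [set: 'I_M]) \bigcup_(r in [set r | (r < t)%N])
         sigma_vec (N i r)) >>.

Definition adapted (U : 'I_M -> nat -> Omega -> R) : Prop :=
  forall i t (B : set R), (t < T)%N -> measurable B ->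
    filtration t (U i t @^-1` B).

Definition dynamics (X : forall i : 'I_M, nat -> Omega -> 'cV[R]_(sdim G i))
    (U : 'I_M -> nat -> Omega -> R) : Prop :=
  (forall i w, X i 0%N w = X0 i w) /\
  (forall i t w, (t < T)%N -> X i t.+1 w = step (X i t w) (U i t w) + N i t w).

Definition feasible (X : forall i : 'I_M, nat -> Omega -> 'cV[R]_(sdim G i))
    (U : 'I_M -> nat -> Omega -> R) : Prop :=
  [/\ dynamics X U,
      forall t w, (t < T)%N -> \sum_(i < M) U i t w = 0 &
      adapted U].

Definition expected_cost
    (X : forall i : 'I_M, nat -> Omega -> 'cV[R]_(sdim G i))
    (U : 'I_M -> nat -> Omega -> R) : \bar R :=
  expectation P (fun w =>
    \sum_(0 <= t < T) \sum_(i < M) stage_cost (X i t w) (U i t w)).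

Definition min_expected_cost : \bar R :=
  ereal_inf [set c | exists X U, feasible X U /\ c = expected_cost X U].

(* One execution of the scheme: at time s and outcome w, [lam s w k t] is the
   price and [u s w k i t] the bid of agent i for time t after k updates. *)
Definition bid_price_run (alpha : nat -> R) (lam0 : nat -> Omega -> nat -> R)
    (lam : nat -> Omega -> nat -> nat -> R)
    (u : nat -> Omega -> nat -> 'I_M -> nat -> R)
    (X : forall i : 'I_M, nat -> Omega -> 'cV[R]_(sdim G i))
    (U : 'I_M -> nat -> Omega -> R) : Prop :=
  [/\ dynamics X U,
      forall s w, (s < T)%N ->
        price_iteration s T (fun i => X i s w) alpha (lam0 s w)
          (lam s w) (u s w) &
      forall i s w, (s < T)%N ->
        U i s w = lim (u s w k i s @[k --> \oo])].

End agents.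
End probability.

(* Main.v *)
Require Import Defs.
From HB Require Import structures.
From mathcomp Require Import all_boot all_order all_algebra.
From mathcomp Require Import all_classical all_reals all_analysis.
From mathcomp Require Import measurable_realfun ring lra.
Import Order.TTheory GRing.Theory Num.Theory.
Import numFieldNormedType.Exports.
Local Open Scope classical_set_scope.
Local Open Scope ring_scope.
Set Implicit Arguments.
Unset Strict Implicit.
Unset Printing Implicit Defensive.

(** In each planning problem the total demand of the agents is an affine
    function of the prices whose linear part is minus a positive definite
    matrix, so the price iteration is a gradient descent with vanishing,
    non-summable steps: it converges to the clearing price, and by duality the
    limiting bids solve the deterministic balanced problem.  Their optimal value
    [value n x] is a quadratic function of the state satisfying the Bellman
    equation, and the scheme always plays its minimizer.  Under any admissible
    control of finite cost, the noise [N t] is uncorrelated with the past, so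
    the expected value after the noise is the expected value before it plus
    [E (value n (N t))], which does not depend on the control.  Telescoping
    bounds every cost from below by the same constant, which the scheme
    attains. *)

(** * Gradient descent with a positive definite matrix *)

Section dot.
Context (R : realType).

Definition dot n (u v : 'cV[R]_n) : R := (u^T *m v) 0 0.

Lemma dotE n (u v : 'cV[R]_n) : dot u v = \sum_i u i 0 * v i 0.
Proof. by rewrite /dot mxE; apply: eq_bigr => i _; rewrite mxE. Qed.

Lemma dotC n (u v : 'cV[R]_n) : dot u v = dot v u.
Proof. by rewrite !dotE; apply: eq_bigr => i _; rewrite mulrC. Qed.

Lemma dotDl n (u v w : 'cV[R]_n) : dot (u + v) w = dot u w + dot v w.
Proof. by rewrite /dot linearD mulmxDl mxE. Qed.

Lemma dotDr n (u v w : 'cV[R]_n) : dot w (u + v) = dot w u + dot w v.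
Proof. by rewrite dotC dotDl !(dotC w). Qed.

Lemma dotZl n a (u v : 'cV[R]_n) : dot (a *: u) v = a * dot u v.
Proof. by rewrite /dot linearZ/= -scalemxAl mxE. Qed.

Lemma dotZr n a (u v : 'cV[R]_n) : dot u (a *: v) = a * dot u v.
Proof. by rewrite dotC dotZl dotC. Qed.

Lemma dotNl n (u v : 'cV[R]_n) : dot (- u) v = - dot u v.
Proof. by rewrite -scaleN1r dotZl mulN1r. Qed.

Lemma dotNr n (u v : 'cV[R]_n) : dot u (- v) = - dot u v.
Proof. by rewrite dotC dotNl dotC. Qed.

Lemma dot0l n (v : 'cV[R]_n) : dot 0 v = 0.
Proof. by rewrite -(scale0r 0) dotZl mul0r. Qed.

Lemma dot_suml n (I : Type) (s : seq I) (F : I -> 'cV[R]_n) v :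
  dot (\sum_(i <- s) F i) v = \sum_(i <- s) dot (F i) v.
Proof.
by elim/big_rec2: _ => [|i x y _ <-]; rewrite ?dot0l// dotDl.
Qed.

Lemma dot_sumr n (I : Type) (s : seq I) (F : I -> 'cV[R]_n) v :
  dot v (\sum_(i <- s) F i) = \sum_(i <- s) dot v (F i).
Proof. by rewrite dotC dot_suml; apply: eq_bigr => i _; rewrite dotC. Qed.

Lemma dot_mulr m n (A : 'M[R]_(m, n)) u v : dot u (A *m v) = dot (A^T *m u) v.
Proof. by rewrite /dot trmx_mul trmxK mulmxA. Qed.

Lemma dot_ge0 n (u : 'cV[R]_n) : 0 <= dot u u.
Proof. by rewrite dotE sumr_ge0// => i _; rewrite -expr2 sqr_ge0. Qed.

Lemma sqr_le_dot n (u : 'cV[R]_n) i : u i 0 ^+ 2 <= dot u u.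
Proof.
rewrite dotE (bigD1 i)//= -expr2 lerDl sumr_ge0// => j _.
by rewrite -expr2 sqr_ge0.
Qed.

Lemma dot_eq0 n (u : 'cV[R]_n) : dot u u <= 0 -> u = 0.
Proof.
move=> u0; apply/matrixP => i j; rewrite ord1 mxE; apply/eqP.
by rewrite -sqrf_eq0 eq_le sqr_ge0 andbT (le_trans (sqr_le_dot u i)).
Qed.

Lemma quadE n (Q : 'M[R]_n) x : quad Q x = dot x (Q *m x).
Proof. by rewrite /quad /dot mulmxA. Qed.

Lemma quadD n (Q : 'M[R]_n) x y : Q^T = Q ->
  quad Q (x + y) = quad Q x + 2 * dot y (Q *m x) + quad Q y.
Proof.
move=> sQ; rewrite !quadE mulmxDr !dotDl !dotDr (dot_mulr Q x y) sQ.
rewrite (dotC (Q *m x)); ring.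
Qed.

Lemma dot_cauchy_schwarz n (u v : 'cV[R]_n) :
  dot u v ^+ 2 <= dot u u * dot v v.
Proof.
have [v0|v0] := leP (dot v v) 0.
  by rewrite (dot_eq0 v0) dotC !dot0l expr0n mulr0.
rewrite -ler_pdivrMr//.
have := dot_ge0 (u - (dot u v / dot v v) *: v).
rewrite dotDl !dotDr !dotNl !dotNr !dotZl !dotZr (dotC v u) opprK.
have -> : dot u v / dot v v * (dot u v / dot v v * dot v v) =
  dot u v ^+ 2 / dot v v by field; rewrite gt_eqF.
have -> : dot u v / dot v v * dot u v = dot u v ^+ 2 / dot v v by ring.
move: (_ / _) => q. lra.
Qed.

(** Cauchy-Schwarz on each row of [A]; the summand 1 keeps [L] positive, so that it can be divided
    by. *)
Lemma dot_mul_bounded m n (A : 'M[R]_(m, n)) :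
  exists2 L : R, 0 < L & forall v, dot (A *m v) (A *m v) <= L * dot v v.
Proof.
exists (1 + \sum_i dot (row i A)^T (row i A)^T) => [|v].
  by rewrite ltr_pwDl// sumr_ge0// => i _; exact: dot_ge0.
rewrite mulrDl mul1r mulr_suml dotE ler_wpDl ?dot_ge0// ler_sum// => i _.
rewrite -expr2 (_ : (A *m v) i 0 = dot (row i A)^T v).
  exact: dot_cauchy_schwarz.
by rewrite /dot trmxK -row_mul [RHS]mxE.
Qed.

Definition coercive n (r : R) (A : 'M[R]_n) : Prop :=
  0 < r /\ forall v, r * dot v v <= dot v (A *m v).

(** A row vector [v] with [v A = 0] makes the quadratic form vanish at [v^T], so coercivity forces
    [v = 0]. *)
Lemma coercive_unit n r (A : 'M[R]_n) : coercive r A -> A \in unitmx.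
Proof.
case=> r0 cA; rewrite -unitmx_tr -row_free_unit -kermx_eq0; apply/rowV0P => v.
move/sub_kermxP => vA; apply: trmx_inj; rewrite trmx0; apply: dot_eq0.
rewrite -(pmulr_rle0 _ r0) (le_trans (cA _))//.
by rewrite -[A]trmxK -trmx_mul vA trmx0 dotC dot0l.
Qed.

(** With [v = A w], the form of the inverse at [v] is [dot w (A w)], at least [r |w|^2], which is at
    least [(r / L) |A w|^2]. *)
Lemma coercive_inv n r (A : 'M[R]_n) : coercive r A ->
  exists r', coercive r' (invmx A).
Proof.
move=> cA; have uA := coercive_unit cA; case: cA => r0 cA.
have [L L0 AL] := dot_mul_bounded A; exists (r / L).
split=> [|v]; first exact: divr_gt0.
set w := invmx A *m v; have : v = A *m w by rewrite mulmxA mulmxV// mul1mx.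
move: w => w ->; rewrite [leRHS]dotC.
rewrite (le_trans _ (cA w))// -mulrA ler_pM2l// ler_pdivrMl//.
Qed.

End dot.

(** * Convergence with vanishing, non-summable steps *)

Section step_sizes.
Context (R : realType) (alpha : nat -> R).
Hypothesis halpha : step_sizes alpha.

Lemma step_sizes_sum_unbounded (K : nat) (B : R) :
  \forall n \near \oo, B <= \sum_(K <= k < n) alpha k.
Proof.
case: halpha => a0 _ aoo.
have : (fun n => \sum_(0 <= k < n) (alpha k)%:E)%E @ \oo --> +oo%E.
  rewrite -aoo; apply: is_cvg_nneseries => n _ _.
  by rewrite lee_fin ltW.
move=> /cvgeyPge /(_ (B + \sum_(0 <= k < K) alpha k)) H.
near=> n; have : ((B + \sum_(0 <= k < K) alpha k)%:E <=
  \sum_(0 <= k < n) (alpha k)%:E)%E by near: n.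
rewrite sumEFin lee_fin [leRHS](big_cat_nat (n := K))//=; last first.
  by near: n; exact: nbhs_infty_ge.
by rewrite [leRHS]addrC lerD2r.
Unshelve. all: by end_near. Qed.

(** In the expansion of [|e - a S e|^2], once [a L <= mu] the quadratic term uses up at most half of
    the decrease due to the linear one, which leaves the factor [1 - a mu]. The product of these
    factors tends to 0 because the steps are not summable. *)
Lemma gradient_descent_cvg n (mu : R) (S : 'M[R]_n) (e : nat -> 'cV[R]_n) :
  coercive mu S -> (forall k, e k.+1 = e k - alpha k *: (S *m e k)) ->
  forall i, e k i 0 @[k --> \oo] --> (0 : R).
Proof.
move=> [mu0 cS] eE i; have [a0 a_cvg _] := halpha.
have [L L0 SL] := dot_mul_bounded S.
pose d k := dot (e k) (e k).
have dS k : alpha k * L <= mu -> d k.+1 <= (1 - alpha k * mu) * d k.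
  move=> aL; rewrite /d eE dotDl !dotDr !dotNl !dotNr !dotZl !dotZr.
  rewrite (dotC (S *m _) (e k)).
  have := cS (e k); have := SL (e k); have := a0 k; have := dot_ge0 (e k).
  set z := dot (S *m _) _; set y := dot _ (S *m _); set x := dot (e k) (e k).
  move=> x0 ak0 zL xy.
  have : alpha k * (alpha k * z) <= alpha k * (mu * x).
    rewrite ler_pM2l// (le_trans (y := alpha k * (L * x)))// ?ler_pM2l//.
    by rewrite mulrA ler_wpM2r.
  have : alpha k * (mu * x) <= alpha k * y by rewrite ler_pM2l.
  lra.
have [K _ aK] : \forall k \near \oo, alpha k * L <= mu.
  have : alpha k * L @[k --> \oo] --> 0 * L by exact: cvgMl.
  by rewrite mul0r => /cvgr_le; apply.
pose s k := \sum_(K <= j < k) alpha j.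
have s0 k : 0 <= s k by rewrite sumr_ge0// => j _; rewrite ltW.
(* The factor 1 + mu * s k replaces the product of the (1 - mu * alpha j)^-1,
   since (1 - a) (1 + b + a) <= 1 + b. *)
have ds k : (K <= k)%N -> d k * (1 + mu * s k) <= d K.
  have sK : d K * (1 + mu * s K) <= d K by rewrite /s big_geq// mulr0 addr0 mulr1.
  elim: k => [|k IH]; first by rewrite leqn0 => /eqP <-.
  rewrite leq_eqVlt => /predU1P[<-//|].
  rewrite ltnS => Kk; apply: le_trans (IH Kk).
  have -> : s k.+1 = s k + alpha k by rewrite /s big_nat_recr.
  have dk0 : 0 <= d k by exact: dot_ge0.
  apply: (@le_trans _ _ ((1 - alpha k * mu) * d k * (1 + mu * (s k + alpha k)))).
    rewrite ler_wpM2r// ?dS ?aK// addr_ge0// mulr_ge0 ?addr_ge0//; exact: ltW.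
  rewrite [leLHS](_ : _ = d k * (1 + mu * s k) -
    d k * ((alpha k * mu) * (mu * s k) + (alpha k * mu) ^+ 2)); last by ring.
  rewrite lerBlDr lerDl mulr_ge0// addr_ge0 ?sqr_ge0//.
  by rewrite !mulr_ge0// ltW.
apply/cvgr0Pnorm_lt => eps eps0.
(* The threshold gives [d K <= eps^2 mu s k]; if [d k] were at least [eps^2], then [ds] would yield
   [eps^2 (1 + mu s k) <= eps^2 mu s k]. *)
have := step_sizes_sum_unbounded K (d K / eps ^+ 2 / mu).
apply: filter_app; near=> k => sk.
rewrite -(@ltr_pXn2r _ 2)// ?nnegrE// ?ltW// real_normK ?num_real//.
apply: (le_lt_trans (sqr_le_dot _ _)).
have Kk : (K <= k)%N by near: k; exact: nbhs_infty_ge.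
have := ds _ Kk; rewrite -/(d k) => dk.
have dsk : d K <= eps ^+ 2 * (mu * s k).
  by move: sk; rewrite ler_pdivrMr// ler_pdivrMr ?exprn_gt0// mulrC (mulrC _ mu).
rewrite ltNge; apply/negP => epsd.
have : eps ^+ 2 * (1 + mu * s k) <= eps ^+ 2 * (mu * s k).
  rewrite (le_trans _ dsk)// (le_trans _ dk)// ler_wpM2r// addr_ge0//.
  by rewrite mulr_ge0// ltW.
by rewrite mulrDr mulr1 gerDr leNgt exprn_gt0.
Unshelve. all: by end_near. Qed.

End step_sizes.

(** * Deterministic planning problems *)

Section system.
Context (R : realType) (M : nat) (G : lqg_system R M).
Implicit Types (i : 'I_M) (n t : nat).

(** Time is counted from the start of the planning window, so that a problem depends only on its
    number [n] of remaining steps; [optimal_bidP] makes the shift. *)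
Fixpoint traj i (x : 'cV[R]_(sdim G i)) (u : nat -> R) t : 'cV[R]_(sdim G i) :=
  if t is t'.+1 then step (traj x u t') (u t') else x.

Definition open_cost i n (x : 'cV[R]_(sdim G i)) (u : nat -> R) : R :=
  \sum_(t < n) stage_cost (traj x u t) (u t).

Lemma trajS i (x : 'cV[R]_(sdim G i)) u t :
  traj x u t.+1 = traj (step x (u 0%N)) (fun r => u r.+1) t.
Proof. by elim: t => //= t <-. Qed.

Lemma eq_traj i (x : 'cV[R]_(sdim G i)) u v n t :
  (forall r, (r < n)%N -> u r = v r) -> (t <= n)%N -> traj x u t = traj x v t.
Proof. by move=> uv; elim: t => //= t IH tn; rewrite IH 1?ltnW// uv. Qed.

Lemma eq_open_cost i n (x : 'cV[R]_(sdim G i)) u v :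
  (forall r, (r < n)%N -> u r = v r) -> open_cost n x u = open_cost n x v.
Proof.
move=> uv; apply: eq_bigr => t _.
by rewrite (eq_traj _ uv) 1?ltnW// uv.
Qed.

Lemma open_costS i n (x : 'cV[R]_(sdim G i)) u : open_cost n.+1 x u =
  stage_cost x (u 0%N) + open_cost n (step x (u 0%N)) (fun r => u r.+1).
Proof.
rewrite /open_cost big_ord_recl; congr (_ + _).
by apply: eq_bigr => t _; rewrite lift0 -trajS.
Qed.

(** Reading an entry by a matrix product makes the action at time [t] visibly linear in the plan. *)
Definition pick_row n t : 'rV[R]_n := \row_j ((j : nat) == t)%:R.

(* Equal to [0] at times [t >= n]. *)
Definition seq_of_col n (v : 'cV[R]_n) t : R := (pick_row n t *m v) 0 0.

Definition col_of_seq n (u : nat -> R) : 'cV[R]_n := \col_j u j.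

Lemma seq_of_colE n (v : 'cV[R]_n) (j : 'I_n) : seq_of_col v j = v j 0.
Proof.
rewrite /seq_of_col mxE (bigD1 j)//= mxE eqxx mul1r big1 ?addr0// => k kj.
by rewrite mxE (inj_eq val_inj) (negbTE kj) mul0r.
Qed.

Lemma seq_of_colD n (u v : 'cV[R]_n) t :
  seq_of_col (u + v) t = seq_of_col u t + seq_of_col v t.
Proof. by rewrite /seq_of_col mulmxDr mxE. Qed.

Lemma col_of_seqK n (u : nat -> R) t : (t < n)%N ->
  seq_of_col (col_of_seq n u) t = u t.
Proof. by move=> tn; rewrite (seq_of_colE _ (Ordinal tn)) mxE. Qed.

Fixpoint free_resp i t : 'M[R]_(sdim G i) :=
  if t is t'.+1 then matA G i *m free_resp i t' else 1%:M.

(** Column [j] is [A^(t-1-j) B] for [j < t] and 0 otherwise: the effect on the state at time [t] of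
    an input at time [j]. *)
Fixpoint input_resp i n t : 'M[R]_(sdim G i, n) :=
  if t is t'.+1 then matA G i *m input_resp i n t' + matB G i *m pick_row n t'
  else 0.

Lemma traj_col i n (x : 'cV[R]_(sdim G i)) (v : 'cV[R]_n) t :
  traj x (seq_of_col v) t = free_resp i t *m x + input_resp i n t *m v.
Proof.
elim: t => [|t /= ->]; first by rewrite /= mul1mx mul0mx addr0.
rewrite /step mulmxDr mulmxDl !mulmxA -addrA; congr (_ + (_ + _)).
rewrite -mulmxA [pick_row n t *m v]mx11_scalar mul_mx_scalar.
by rewrite /seq_of_col.
Qed.

(** As a function of the input column [v], the cost is [dot v (hess v) + 2 dot v (cross x)] plus a
    constant: [hess] is half the Hessian, and [cross] half the mixed second derivative in input and
    initial state. *)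
Definition hess i n : 'M[R]_n := \sum_(t < n)
  ((input_resp i n t)^T *m matQ G i *m input_resp i n t +
   wgtR G i *: ((pick_row n t)^T *m pick_row n t)).

Definition cross i n : 'M[R]_(n, sdim G i) :=
  \sum_(t < n) (input_resp i n t)^T *m matQ G i *m free_resp i t.

Section agent.
Hypothesis hQ : forall i, psd (matQ G i).
Hypothesis hR : forall i, 0 < wgtR G i.

Lemma dot_hess i n (u v : 'cV[R]_n) : dot u (hess i n *m v) =
  \sum_(t < n) (dot (input_resp i n t *m u) (matQ G i *m (input_resp i n t *m v))
    + wgtR G i * (seq_of_col u t * seq_of_col v t)).
Proof.
rewrite /hess mulmx_suml dot_sumr; apply: eq_bigr => t _.
rewrite mulmxDl dotDr -!mulmxA dot_mulr trmxK; congr (_ + _).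
rewrite -scalemxAl dotZr; congr (_ * _).
by rewrite -mulmxA dot_mulr trmxK /dot mxE big_ord1 mxE.
Qed.

Lemma dot_cross i n (u : 'cV[R]_n) (x : 'cV[R]_(sdim G i)) :
  dot u (cross i n *m x) =
  \sum_(t < n) dot (input_resp i n t *m u) (matQ G i *m (free_resp i t *m x)).
Proof.
rewrite /cross mulmx_suml dot_sumr; apply: eq_bigr => t _.
by rewrite -!mulmxA dot_mulr trmxK.
Qed.

(** The state weights contribute nonnegative terms, and the action weight contributes exactly
    [wgtR G i * dot v v]. *)
Lemma hess_coercive i n : coercive (wgtR G i) (hess i n).
Proof.
split=> // v; rewrite dot_hess dotE mulr_sumr; apply: ler_sum => t _.
rewrite seq_of_colE lerDr -quadE; exact: (hQ i).2.
Qed.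

(** Exact second-order Taylor expansion; the gradient at [v] is twice [hess v + cross x]. *)
Lemma open_costD i n (x : 'cV[R]_(sdim G i)) (v h : 'cV[R]_n) :
  open_cost n x (seq_of_col (v + h)) = open_cost n x (seq_of_col v)
    + 2 * dot h (hess i n *m v + cross i n *m x) + dot h (hess i n *m h).
Proof.
rewrite dotDr !dot_hess dot_cross -big_split/= mulr_sumr -!big_split/=.
apply: eq_bigr => t _; rewrite /stage_cost !traj_col mulmxDr addrA.
rewrite quadD; last exact: (hQ i).1.
rewrite mulmxDr dotDr -quadE.
by rewrite seq_of_colD; ring.
Qed.

(** The zero of the gradient [2 (hess v + cross x) + lam] of the priced cost. *)
Definition bid i n (x : 'cV[R]_(sdim G i)) (lam : 'cV[R]_n) : 'cV[R]_n :=
  - (invmx (hess i n) *m (cross i n *m x + 2^-1 *: lam)).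

Definition priced_cost i n (x : 'cV[R]_(sdim G i)) lam (v : 'cV[R]_n) : R :=
  open_cost n x (seq_of_col v) + dot lam v.

(** Completing the square: the linear term of the expansion vanishes at the stationary point.
    Minimality and uniqueness of the bid both follow from coercivity. *)
Lemma priced_cost_bid i n (x : 'cV[R]_(sdim G i)) lam (v : 'cV[R]_n) :
  priced_cost x lam v = priced_cost x lam (bid x lam) +
    dot (v - bid x lam) (hess i n *m (v - bid x lam)).
Proof.
have gradE : hess i n *m bid x lam + cross i n *m x = - 2^-1 *: lam.
  rewrite /bid mulmxN mulKVmx; last exact/coercive_unit/hess_coercive.
  by rewrite opprD addrAC addNr add0r scaleNr.
set h := v - _; rewrite -{1}(subrKC (bid x lam) v) -/h /priced_cost.
rewrite open_costD gradE dotDr -!addrA; congr (_ + _).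
rewrite dotZr (dotC h lam); lra.
Qed.

Lemma bid_min i n (x : 'cV[R]_(sdim G i)) lam (v : 'cV[R]_n) :
  priced_cost x lam (bid x lam) <= priced_cost x lam v.
Proof.
rewrite [leRHS]priced_cost_bid lerDl.
have [r0 /(_ (v - bid x lam))] := hess_coercive i n; apply: le_trans.
by rewrite mulr_ge0 ?dot_ge0// ltW.
Qed.

Lemma bid_unique i n (x : 'cV[R]_(sdim G i)) lam (v : 'cV[R]_n) :
  priced_cost x lam v <= priced_cost x lam (bid x lam) -> v = bid x lam.
Proof.
rewrite priced_cost_bid gerDl => vb; apply/eqP; rewrite -subr_eq0; apply/eqP.
apply: dot_eq0; have [r0 H] := hess_coercive i n.
by rewrite -(pmulr_rle0 _ r0) (le_trans (H _)).
Qed.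

(** On the window the inputs determine the states, so the problem of the agent is to minimize
    [priced_cost] over columns holding the window values shifted to time 0. *)
Lemma optimal_bidP i s n (x0 : 'cV[R]_(sdim G i)) (price u : nat -> R) :
  optimal_bid s (s + n) x0 price u <->
  col_of_seq n (fun t => u (s + t)%N) =
    bid x0 (col_of_seq n (fun t => price (s + t)%N)).
Proof.
have open_loopE x v : open_loop s (s + n) x0 x v -> forall t, (t <= n)%N ->
    x (s + t)%N = traj x0 (fun t => v (s + t)%N) t.
  case=> xs xS; elim=> [|t IH] tn; first by rewrite addn0.
  by rewrite addnS xS ?leq_addr ?ltn_add2l// IH// ltnW.
have costE x v : open_loop s (s + n) x0 x v -> agent_cost s (s + n) price x v =
    priced_cost x0 (col_of_seq n (fun t => price (s + t)%N))
      (col_of_seq n (fun t => v (s + t)%N)).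
  move=> xv; rewrite /agent_cost /priced_cost -{1}[s]addn0 addnC big_addn addKn.
  rewrite big_mkord big_split/=; congr (_ + _).
    rewrite /open_cost; apply: eq_bigr => t _; rewrite col_of_seqK// addnC.
    rewrite (open_loopE x v)// 1?ltnW//; congr (stage_cost _ _).
    by apply: (@eq_traj _ _ _ _ n) => [r rn|]; rewrite ?col_of_seqK// ltnW.
  by rewrite dotE; apply: eq_bigr => t _; rewrite !mxE addnC.
have loop v : exists x, open_loop s (s + n) x0 x v.
  exists (fun t => traj x0 (fun t => v (s + t)%N) (t - s)); split.
    by rewrite subnn.
  by move=> t /andP[st _]; rewrite subSn//= subnKC.
split=> [[x [xu xmin]]|uE].
  apply: bid_unique; rewrite -(costE x)//.
  set p := col_of_seq _ _; set b := bid _ _.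
  have [x' x'b] := loop (fun t => seq_of_col b (t - s)).
  rewrite (le_trans (xmin _ _ x'b))// (costE x')//.
  rewrite (_ : col_of_seq _ (fun t => _ _ (_ - _)%N) = b)//.
  by apply/matrixP => j k; rewrite ord1 mxE addKn seq_of_colE.
have [x xu] := loop u; exists x; split=> // x' u' x'u'.
by rewrite !costE// uE bid_min.
Qed.

End agent.
End system.

(** * Market clearing, value function and Bellman equation *)

Section joint.
Context (R : realType) (M : nat) (G : lqg_system R M).
Hypothesis hQ : forall i, psd (matQ G i).
Hypothesis hR : forall i, 0 < wgtR G i.
Implicit Types (i : 'I_M) (n t : nat).
Local Notation state := (forall i, 'cV[R]_(sdim G i)).
Implicit Types (x y z : state).

(** Minus the derivative of the total demand with respect to the prices; [clearing_price] is the
    price vector at which the total demand vanishes. *)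
Definition demand_slope n : 'M[R]_n := 2^-1 *: \sum_i invmx (hess G i n).

Definition clearing_price n x : 'cV[R]_n :=
  - (invmx (demand_slope n) *m
     \sum_i (invmx (hess G i n) *m (cross G i n *m x i))).

Definition plan n x i : 'cV[R]_n := bid (x i) (clearing_price n x).

(** One agent already gives a coercive summand and the others only add nonnegative terms; [i0] rules
    out the empty sum. *)
Lemma demand_slope_coercive (i0 : 'I_M) n :
  exists mu, coercive mu (demand_slope n).
Proof.
have ci i := coercive_inv (hess_coercive hQ hR i n).
have [r [r0 Hr]] := ci i0; exists (2^-1 * r); split.
  by rewrite mulr_gt0// invr_gt0.
move=> v; rewrite /demand_slope -scalemxAl dotZr -mulrA ler_pM2l ?invr_gt0//.
rewrite mulmx_suml dot_sumr (bigD1 i0)//= ler_wpDr ?Hr// sumr_ge0// => i _.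
have [ri [ri0 Hi]] := ci i; apply: le_trans (Hi v).
by rewrite mulr_ge0 ?dot_ge0 ?ltW.
Qed.

Lemma sum_bid n x (lam : 'cV[R]_n) :
  \sum_i bid (x i) lam = - (demand_slope n *m (lam - clearing_price n x)).
Proof.
(* With no agents the slope is 0 and cannot be inverted, but both sides are 0. *)
case: (pickP 'I_M) => [i0 _|M0]; last first.
  rewrite big1 => [|i]; last by have := M0 i.
  by rewrite /demand_slope big1 ?scaler0 ?mul0mx ?oppr0// => i; have := M0 i.
have [mu /coercive_unit uS] := demand_slope_coercive i0 n.
rewrite /clearing_price opprK mulmxDr mulKVmx// addrC.
rewrite /bid sumrN; congr (- _).
rewrite /demand_slope -scalemxAl mulmx_suml scaler_sumr -big_split/=.
by apply: eq_bigr => i _; rewrite mulmxDr -scalemxAr.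
Qed.

Lemma plan_balanced n x : \sum_i plan n x i = 0.
Proof. by rewrite sum_bid subrr mulmx0 oppr0. Qed.

Definition value n x : R :=
  \sum_i open_cost n (x i) (seq_of_col (plan n x i)).

(** Lagrangian duality: on balanced controls the price terms sum to 0, so the total cost equals the
    total priced cost, which the clearing bids minimize agent by agent. *)
Lemma value_min n x (u : nat -> 'I_M -> R) :
  (forall t, (t < n)%N -> \sum_i u t i = 0) ->
  value n x <= \sum_i open_cost n (x i) (fun t => u t i).
Proof.
move=> u0; pose lam := clearing_price n x.
have colsum (v : 'I_M -> 'cV[R]_n) : \sum_i v i = 0 ->
    \sum_i open_cost n (x i) (seq_of_col (v i)) =
    \sum_i priced_cost (x i) lam (v i).
  move=> v0; rewrite /priced_cost big_split/= -dot_sumr v0.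
  by rewrite dotC dot0l addr0.
rewrite /value colsum; last exact: plan_balanced.
have -> : \sum_i open_cost n (x i) (fun t => u t i) =
    \sum_i open_cost n (x i) (seq_of_col (col_of_seq n (fun t => u t i))).
  by apply: eq_bigr => i _; apply: eq_open_cost => t tn; rewrite col_of_seqK.
rewrite colsum; first by apply: ler_sum => i _; exact: bid_min.
apply/matrixP => j k; rewrite ord1 summxE mxE -[RHS](u0 j)//.
by apply: eq_bigr => i _; rewrite mxE.
Qed.

Lemma value0 x : value 0 x = 0.
Proof. by rewrite /value big1// => i _; rewrite /open_cost big_ord0. Qed.

(** Playing [v] and then the optimal plan from the next state is a balanced control over [n + 1]
    steps. *)
Lemma value_bellman_le n x (v : 'I_M -> R) : \sum_i v i = 0 ->
  value n.+1 x <= \sum_i stage_cost (x i) (v i) +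
                  value n (fun i => step (x i) (v i)).
Proof.
move=> v0; set y := fun i => _.
pose u t i := if t is t'.+1 then seq_of_col (plan n y i) t' else v i.
have uE t : (t < n.+1)%N -> \sum_i u t i = 0.
  case: t => [//|t] tn; rewrite /u /seq_of_col.
  by rewrite -summxE -mulmx_sumr plan_balanced mulmx0 mxE.
rewrite (le_trans (value_min x uE))// /value -big_split/=.
by apply: ler_sum => i _; rewrite open_costS.
Qed.

(** For the converse inequality, the tail of the optimal plan is balanced, hence costs at least
    [value n] at the next state. *)
Lemma value_bellman n x (v := fun i => seq_of_col (plan n.+1 x i) 0) :
  value n.+1 x = \sum_i stage_cost (x i) (v i) +
                 value n (fun i => step (x i) (v i)).
Proof.
have bal t : \sum_i seq_of_col (plan n.+1 x i) t = 0.
  by rewrite /seq_of_col -summxE -mulmx_sumr plan_balanced mulmx0 mxE.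
apply/eqP; rewrite eq_le value_bellman_le/=; last exact: bal.
rewrite [leRHS](_ : _ = \sum_i stage_cost (x i) (v i) + \sum_i open_cost n
    (step (x i) (v i)) (fun t => seq_of_col (plan n.+1 x i) t.+1)); last first.
  by rewrite -big_split/=; apply: eq_bigr => i _; rewrite open_costS.
by rewrite lerD2l value_min.
Qed.

Lemma planD n y z i : plan n (fun i => y i + z i) i = plan n y i + plan n z i.
Proof.
have pD : clearing_price n (fun i => y i + z i) =
    clearing_price n y + clearing_price n z.
  rewrite /clearing_price -opprD -mulmxDr -big_split/=.
  by congr (- (_ *m _)); apply: eq_bigr => j _; rewrite !mulmxDr.
rewrite /plan pD /bid; move: (clearing_price n y) (clearing_price n z) => p q.
by rewrite -opprD -mulmxDr (mulmxDr (cross _ _ _)) scalerDr addrACA.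
Qed.

Definition plan_traj n x i t : 'cV[R]_(sdim G i) :=
  free_resp G i t *m x i + input_resp G i n t *m plan n x i.

(** The bilinear form polar to the quadratic form [value n]; it is quadratic because plans are
    linear in the state. *)
Definition value_polar n y z : R := \sum_i \sum_(t < n)
  (dot (plan_traj n z i t) (matQ G i *m plan_traj n y i t) +
   wgtR G i * (seq_of_col (plan n y i) t * seq_of_col (plan n z i) t)).

Lemma valueD n y z :
  value n (fun i => y i + z i) = value n y + 2 * value_polar n y z + value n z.
Proof.
rewrite /value /value_polar mulr_sumr -!big_split/=; apply: eq_bigr => i _.
rewrite /open_cost mulr_sumr -!big_split/=; apply: eq_bigr => t _.
rewrite /stage_cost !traj_col -!/(plan_traj _ _ _ _).
have -> : plan_traj n (fun i => y i + z i) i t =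
    plan_traj n y i t + plan_traj n z i t.
  by rewrite /plan_traj planD !mulmxDr addrACA.
rewrite quadD; last exact: (hQ i).1.
rewrite planD seq_of_colD.
move: (plan_traj n y i t) (plan_traj n z i t) => p q.
move: (seq_of_col _ t) (seq_of_col _ t) => a b.
move: (quad _ _) (quad _ _) (dot _ _) => k l m; ring.
Qed.

(** * Convergence and existence of the price iteration *)

Section iteration.
Variables (alpha : nat -> R) (s n : nat).
Hypothesis halpha : step_sizes alpha.

(** By [sum_bid] the excess demand is [- S e], where [e] is the distance to the clearing price and
    [S] the demand slope, so the update is gradient descent on [e]. Bids are affine in the prices
    and converge with them. *)
Lemma price_iteration_cvg x0 lam0 lam u :
  price_iteration s (s + n) x0 alpha lam0 lam u ->
  forall i t, (t < n)%N ->
    u k i (s + t)%N @[k --> \oo] --> seq_of_col (plan n x0 i) t.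
Proof.
case=> _ ubid lamS i t tn.
pose L k := col_of_seq n (fun t => lam k (s + t)%N).
have uE k j : col_of_seq n (fun t => u k j (s + t)%N) = bid (x0 j) (L k).
  exact/optimal_bidP.
pose e k := L k - clearing_price n x0.
have eS k : e k.+1 = e k - alpha k *: (demand_slope n *m e k).
  rewrite -scalerN -sum_bid /e [RHS]addrAC; congr (_ - _).
  apply/matrixP => j c; rewrite !mxE lamS; last by rewrite leq_addr ltn_add2l/=.
  congr (_ + _ * _); rewrite summxE; apply: eq_bigr => a _.
  by rewrite -uE mxE.
have [mu cS] := demand_slope_coercive i n.
have e0 := gradient_descent_cvg halpha cS eS.
(* The bid differs from the plan by [- 2^-1 hess^-1 e]; the sum is one entry of [hess^-1 e], so that
   entrywise convergence of [e] is enough. *)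
have uE' k : u k i (s + t)%N = seq_of_col (plan n x0 i) t -
    2^-1 * \sum_j (pick_row R n t *m invmx (hess G i n)) 0 j * e k j 0.
  rewrite -(@col_of_seqK _ n (fun t => u k i (s + t)%N))// uE.
  rewrite (_ : \sum_j _ = seq_of_col (invmx (hess G i n) *m e k) t); last first.
    by rewrite /seq_of_col mulmxA mxE.
  rewrite -(subrK (clearing_price n x0) (L k)) -/(e k) /plan /bid.
  rewrite /seq_of_col scalerDr addrCA addrC mulmxDr opprD mulmxDr mxE.
  by congr (_ + _); rewrite -scalemxAr mulmxN -scalemxAr !mxE.
rewrite (funext uE').
rewrite -[X in _ --> X]subr0; apply: cvgB; first exact: cvg_cst.
rewrite -[X in _ --> X](mulr0 2^-1); apply: cvgMr.
rewrite [X in _ --> X](_ : 0 = \sum_j (pick_row R n t *m invmx (hess G i n)) 0 j * 0).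
  apply: cvg_big => [|j _]; first exact: add_continuous.
  by apply: cvgMr; exact: e0.
by rewrite big1// => j _; rewrite mulr0.
Qed.

Lemma price_iteration_exists x0 lam0 :
  exists lam u, price_iteration s (s + n) x0 alpha lam0 lam u.
Proof.
pose bids (p : nat -> R) i t :=
  seq_of_col (bid (x0 i) (col_of_seq n (fun r => p (s + r)%N))) (t - s).
pose lam := fix lam k := if k is k'.+1 then
  fun t => lam k' t + alpha k' * \sum_i bids (lam k') i t else lam0.
exists lam, (fun k => bids (lam k)); split=> // k i.
apply/optimal_bidP => //; apply/matrixP => j c; rewrite ord1 mxE /bids addKn.
by rewrite seq_of_colE.
Qed.

End iteration.
End joint.

(** * Square-integrable and Gaussian variables *)

Section square_integrable.
Context (R : realType) d (Omega : measurableType d) (P : probability Omega R).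
Implicit Types (f g : Omega -> R).

(** A linear subspace of random variables. Closure under matrix operations is proved once and then
    used for measurable, integrable, square-integrable, past, innovation and centered variables. *)
Definition linear_class (K : (Omega -> R) -> Prop) : Prop :=
  K (cst 0) /\ forall a f g, K f -> K g -> K (fun w => a * f w + g w).

Definition entrywise (K : (Omega -> R) -> Prop) n (V : Omega -> 'cV[R]_n) :=
  forall j, K (fun w => V w j 0).

Section entrywise.
Variables (K : (Omega -> R) -> Prop) (hK : linear_class K).

Lemma linear_classZ a f : K f -> K (fun w => a * f w).
Proof.
case: hK => K0 KD Kf; have := KD a f _ Kf K0; congr K.
by apply/funext => w; rewrite addr0.
Qed.

Lemma linear_classD f g : K f -> K g -> K (fun w => f w + g w).
Proof.
case: hK => _ KD Kf Kg; have := KD 1 f g Kf Kg; congr K.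
by apply/funext => w; rewrite mul1r.
Qed.

Lemma linear_class_sum (I : Type) (s : seq I) (F : I -> Omega -> R) :
  (forall i, K (F i)) -> K (fun w => \sum_(i <- s) F i w).
Proof.
move=> KF; elim: s => [|i s IH].
  by case: hK => K0 _; move: K0; congr K; apply/funext => w; rewrite big_nil.
have := linear_classD (KF i) IH; congr K.
by apply/funext => w; rewrite big_cons.
Qed.

Lemma entrywiseD n (V W : Omega -> 'cV[R]_n) :
  entrywise K V -> entrywise K W -> entrywise K (fun w => V w + W w).
Proof.
move=> KV KW j; have := linear_classD (KV j) (KW j); congr K.
by apply/funext => w; rewrite mxE.
Qed.

Lemma entrywise_mul m n (A : 'M[R]_(m, n)) (V : Omega -> 'cV[R]_n) :
  entrywise K V -> entrywise K (fun w => A *m V w).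
Proof.
move=> KV j; have := linear_class_sum (index_enum 'I_n)
  (fun k => linear_classZ (A j k) (KV k)); congr K.
by apply/funext => w; rewrite mxE.
Qed.

Lemma entrywiseZ n a (V : Omega -> 'cV[R]_n) :
  entrywise K V -> entrywise K (fun w => a *: V w).
Proof.
move=> KV j; have := linear_classZ a (KV j); congr K.
by apply/funext => w; rewrite mxE.
Qed.

Lemma entrywiseN n (V : Omega -> 'cV[R]_n) :
  entrywise K V -> entrywise K (fun w => - V w).
Proof.
move=> /(entrywiseZ (-1)); congr entrywise.
by apply/funext => w; rewrite scaleN1r.
Qed.

Lemma entrywise_sum n (I : Type) (s : seq I) (F : I -> Omega -> 'cV[R]_n) :
  (forall i, entrywise K (F i)) -> entrywise K (fun w => \sum_(i <- s) F i w).
Proof.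
move=> KF j; have := linear_class_sum s (fun i => KF i j); congr K.
by apply/funext => w; rewrite summxE.
Qed.

End entrywise.

Definition sqint f : Prop := f \in Lfun P 2%:E.

Lemma sqintP f :
  sqint f <-> measurable_fun setT f /\ (\int[P]_w (f w ^+ 2)%:E < +oo)%E.
Proof.
split=> [f2|[mf f2]].
  split; first by move: f2; rewrite /sqint inE => /andP[/[!inE]].
  have /integrableP[_] := Lfun2_integrable_sqr f2; apply: le_lt_trans.
  by under [leRHS]eq_integral => w _ do rewrite gee0_abs ?lee_fin ?sqr_ge0//.
rewrite /sqint inE; apply/andP; split; rewrite inE//=.
rewrite /finite_norm unlock.
rewrite poweR_lty//.
under eq_integral => w _ do rewrite /= powR_mulrn// real_normK ?num_real//.
exact: f2.
Qed.

Lemma linear_class_sqint : linear_class sqint.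
Proof.
split; first exact: Lfun_cst.
by have [_ H] := Lfun_submod_closed P (lee1n 2); exact: H.
Qed.

Definition integr f : Prop := P.-integrable setT (EFin \o f).

Lemma integrD f g : integr f -> integr g -> integr (fun w => f w + g w).
Proof. by move=> f1 g1; have := integrableD measurableT f1 g1. Qed.

Lemma integrZ a f : integr f -> integr (fun w => a * f w).
Proof. by move=> f1; have := integrableZl measurableT a f1. Qed.

Lemma linear_class_integr : linear_class integr.
Proof.
split; first exact: integrable0.
by move=> a f g f1 g1; apply: integrD => //; exact: integrZ.
Qed.

Lemma integrM f g : sqint f -> sqint g -> integr (fun w => f w * g w).
Proof. by move=> f2 g2; apply/Lfun1_integrable; exact: Lfun2_mul_Lfun1. Qed.

Lemma integr_dot n (V W : Omega -> 'cV[R]_n) :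
  entrywise sqint V -> entrywise sqint W -> integr (fun w => dot (V w) (W w)).
Proof.
move=> V2 W2; have := linear_class_sum linear_class_integr (index_enum 'I_n)
  (fun k => integrM (V2 k) (W2 k)); congr integr.
by apply/funext => w; rewrite dotE.
Qed.

Lemma Rintegral_sum (I : Type) (s : seq I) (F : I -> Omega -> R) :
  (forall i, integr (F i)) ->
  \int[P]_w (\sum_(i <- s) F i w) = \sum_(i <- s) \int[P]_w F i w.
Proof.
move=> F1; elim: s => [|i s IH].
  rewrite big_nil -[RHS](mul0r (fine (P setT))) -Rintegral_cst//.
  by apply: eq_Rintegral => w _; rewrite big_nil.
rewrite big_cons -IH -RintegralD//; last 2 first.
- exact: F1.
- exact: (linear_class_sum linear_class_integr s F1).
by apply: eq_Rintegral => w _; rewrite big_cons.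
Qed.

Lemma Rintegral_linear3 a f g h : integr f -> integr g -> integr h ->
  \int[P]_w (f w + a * g w + h w) =
  \int[P]_w f w + a * \int[P]_w g w + \int[P]_w h w.
Proof.
move=> f1 g1 h1; have ag1 := integrZ a g1.
by rewrite RintegralD// ?RintegralD// ?RintegralZl//; exact: integrD.
Qed.

End square_integrable.

(** * Second moments and symmetry of normal laws *)

Section gaussian.
Context (R : realType).
Notation mu := (@lebesgue_measure R).

(** The Radon-Nikodym derivative agrees almost everywhere with the explicit density, since both have
    the same integral over every measurable set. *)
Lemma ge0_integral_normal_prob (s : R) (f : measurableTypeR R -> \bar R) : s != 0 ->
  (forall x, (0 <= f x)%E) -> measurable_fun setT f ->
  (\int[normal_prob 0 s]_x f x = \int[mu]_x (f x * (normal_pdf 0 s x)%:E))%E.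
Proof.
move=> s0 f0 mf.
have dom := @normal_prob_dominates R 0 s.
rewrite -(Radon_Nikodym_SigmaFinite.change_of_variables dom f0 measurableT mf).
apply: ae_eq_integral => //.
- apply: emeasurable_funM => //; apply: (measurable_int mu).
  exact: Radon_Nikodym_SigmaFinite.f_integrable.
- apply: emeasurable_funM => //; apply/measurable_EFinP.
  exact: measurable_normal_pdf.
- apply: ae_eqe_mul2l => /=.
  apply: integral_ae_eq => //=.
  + exact: Radon_Nikodym_SigmaFinite.f_integrable.
  + by apply/measurable_EFinP; exact: measurable_normal_pdf.
  + by move=> A _ mA; rewrite -Radon_Nikodym_SigmaFinite.f_integral.
Qed.

Lemma sqr_mul_normal_pdf_le (s : R) : s != 0 ->
  exists C : R, forall x, x ^+ 2 * normal_pdf 0 s x <= C * normal_pdf 0 (2 * s) x.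
Proof.
move=> s0; have s20 : 2 * s != 0 by rewrite mulf_neq0.
(* y exp(- y) <= 1 at y = x^2 / c, where
   x^2 / (2 s^2) = x^2 / c + x^2 / (2 (2 s)^2). *)
pose c := 8 / 3 * s ^+ 2.
have sq0 : 0 < s ^+ 2 by rewrite exprn_even_gt0.
exists (c * (normal_peak s / normal_peak (2 * s))) => x.
rewrite !normal_pdfE//.
rewrite (_ : c * _ * _ = normal_peak s * (c * normal_fun 0 (2 * s) x)); last first.
  by field; rewrite gt_eqF// normal_peak_gt0.
rewrite mulrCA ler_pM2l ?normal_peak_gt0// /normal_fun subr0.
pose y := x ^+ 2 / c.
have yE : x ^+ 2 = c * y by rewrite mulrC divfK// /c !mulf_neq0// gt_eqF.
have -> : - x ^+ 2 / (s ^+ 2 *+ 2) = - y - x ^+ 2 / ((2 * s) ^+ 2 *+ 2).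
  by rewrite /y /c; field.
rewrite expRD mulNr {1}yE -mulrA ler_pM2l; last by rewrite /c mulr_gt0// divr_gt0.
rewrite mulrA ler_piMl ?expR_ge0// expRN ler_pdivrMr ?expR_gt0// mul1r.
by rewrite (le_trans _ (expR_ge1Dx y))// lerDr.
Qed.

(* For [v < 0], [Num.sqrt v = 0] and [normal_law v] is uniform on [0, 1]. *)
Lemma normal_law_oppr (v : R) (B : set R) : 0 <= v -> measurable B ->
  normal_law v (-%R @^-1` B) = normal_law v B.
Proof.
move=> v0 mB; rewrite /normal_law; case: eqP => [_|/eqP vn0].
  rewrite !diracE; congr (_ %:R%:E).
  by apply: congr1; apply/idP/idP; rewrite !inE/= oppr0.
have s0 : Num.sqrt v != 0 by rewrite sqrtr_eq0 -ltNge lt_def vn0.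
rewrite /normal_prob.
transitivity (\int[mu]_(x in (-%R : measurableTypeR R -> measurableTypeR R) @^-1` B)
    ((fun x => (normal_pdf 0 (Num.sqrt v) x)%:E) \o -%R) x)%E.
  by apply: eq_integral => x _ /=; rewrite !normal_pdfE// /normal_fun !subr0 sqrrN.
have mpdf : measurable_fun setT
    (fun x : measurableTypeR R => (normal_pdf 0 (Num.sqrt v) x)%:E).
  by apply/measurable_EFinP; exact: measurable_normal_pdf.
rewrite -ge0_integral_pushforward//=.
- by apply: eq_measure_integral => A mA _; exact: lebesgue_measureN.
- exact: measurable_funTS.
- by move=> x _; rewrite lee_fin normal_pdf_ge0.
Qed.

(** The integrand is dominated by a multiple of the normal density with doubled standard deviation,
    whose integral is 1. *)
Lemma integral_sqr_normal_prob_lty (s : R) : s != 0 ->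
  (\int[normal_prob 0 s]_x (x ^+ 2)%:E < +oo)%E.
Proof.
move=> s0; rewrite ge0_integral_normal_prob//; last 2 first.
- by move=> x; rewrite lee_fin sqr_ge0.
- by apply/measurable_EFinP; exact: measurable_funX.
have [C HC] := sqr_mul_normal_pdf_le s0.
apply: (@le_lt_trans _ _ (\int[mu]_x (C%:E * (normal_pdf 0 (2 * s) x)%:E))%E).
  apply: ge0_le_integral => //=.
  - by move=> x _; rewrite -EFinM lee_fin mulr_ge0 ?sqr_ge0 ?normal_pdf_ge0.
  - apply/measurable_EFinP; apply: measurable_funM; last exact: measurable_normal_pdf.
    exact: measurable_funX.
  - apply/measurable_EFinP; apply: measurable_funM => //; exact: measurable_normal_pdf.
  - by move=> x _; rewrite -!EFinM lee_fin.
rewrite integralZl//; last exact: integrable_normal_pdf.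
by rewrite integral_normal_pdf mule1 ltry.
Qed.

End gaussian.

(** * Independence and symmetric random variables *)

Section independence.
Context (R : realType) d (Omega : measurableType d) (P : probability Omega R).

(* Independence and the symmetry of Z make (Y, Z) and (Y, - Z) equal in law. *)
Lemma Rintegral_mul_symmetric (Y Z : Omega -> R) :
  sqint P Y -> sqint P Z ->
  (forall A B : set R, measurable A -> measurable B ->
    P (Y @^-1` A `&` Z @^-1` B) = (P (Y @^-1` A) * P (Z @^-1` B))%E) ->
  (forall B : set R, measurable B ->
    P (Z @^-1` (-%R @^-1` B)) = P (Z @^-1` B)) ->
  \int[P]_w (Y w * Z w) = 0.
Proof.
move=> Y2 Z2 indYZ symZ.
have mY : measurable_fun setT Y by case/sqintP : Y2.
have mZ : measurable_fun setT Z by case/sqintP : Z2.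
have mZN : measurable_fun setT (fun w => - Z w) by exact: measurableT_comp.
pose Y' : {RV P >-> R} := HB.pack Y (isMeasurableFun.Build _ _ _ _ Y mY).
pose Z' : {RV P >-> R} := HB.pack Z (isMeasurableFun.Build _ _ _ _ Z mZ).
pose f (z : R * R) : \bar R := (z.1 * z.2)%:E.
have mf : measurable_fun setT f.
  by apply/measurable_EFinP; exact: measurable_funM.
pose YZ w := (Y w, Z w); pose YN w := (Y w, - Z w).
have mYZ : measurable_fun setT YZ by exact: measurable_fun_pair.
have mYN : measurable_fun setT YN by exact: measurable_fun_pair.
have law (W : Omega -> R * R) (mW : measurable_fun setT W) :
    (forall A B : set R, measurable A -> measurable B ->
      P (W @^-1` (A `*` B)) = (P (Y @^-1` A) * P (Z @^-1` B))%E) ->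
    forall X, measurable X ->
      (distribution P Y' \x distribution P Z')%E X = pushforward P W X.
  move=> PW X mX.
  pose W' : {mfun Omega >-> (R * R)%type} :=
    HB.pack W (isMeasurableFun.Build _ _ _ _ W mW).
  exact: (@product_measure_unique _ _ _ _ _ _ _ (distribution P W')).
have eqint : \int[P]_w (Y w * Z w) = \int[P]_w (Y w * - Z w).
  rewrite /Rintegral; congr fine.
  transitivity (\int[pushforward P YZ]_z f z)%E.
    rewrite integral_pushforward//; exact: integrM.
  transitivity (\int[pushforward P YN]_z f z)%E; last first.
    rewrite integral_pushforward//; apply: integrM => //.
    have := linear_classZ (linear_class_sqint P) (-1) Z2; congr sqint.
    by apply/funext => w; rewrite mulN1r.
  apply: eq_measure_integral => X mX _.
  apply: etrans (esym (law YZ mYZ _ X mX)) (law YN mYN _ X mX) => A B mA mB.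
    exact: indYZ.
  rewrite -(symZ B)//; apply: indYZ => //.
  by rewrite -[X in measurable X]setTI; exact: oppr_measurable.
have : \int[P]_w (Y w * - Z w) = - \int[P]_w (Y w * Z w).
  rewrite -mulN1r -RintegralZl//; last exact: integrM.
  by apply: eq_Rintegral => w _; rewrite mulrN mulN1r.
rewrite -eqint; lra.
Qed.

Lemma gaussian_vector_entry n (S : 'M[R]_n) (V : Omega -> 'cV[R]_n) j :
  gaussian_vector P S V ->
  exists2 v : R, 0 <= v & forall B : set R, measurable B ->
    P ((fun w => V w j 0) @^-1` B) = normal_law v B.
Proof.
case=> -[_ S0] _ law; exists (quad S (delta_mx j 0)) => [|B mB]; first exact: S0.
rewrite -law//; congr (P _); apply/seteqP.
by split=> w /=; rewrite trmx_delta -rowE mxE.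
Qed.

Lemma gaussian_vector_symmetric n (S : 'M[R]_n) (V : Omega -> 'cV[R]_n) j
    (B : set R) :
  gaussian_vector P S V -> measurable B ->
  P ((fun w => V w j 0) @^-1` (-%R @^-1` B)) = P ((fun w => V w j 0) @^-1` B).
Proof.
move=> /(gaussian_vector_entry j)[v v0 law] mB; rewrite !law ?normal_law_oppr//.
by rewrite -[X in measurable X]setTI; exact: oppr_measurable.
Qed.

Lemma gaussian_vector_sqint n (S : 'M[R]_n) (V : Omega -> 'cV[R]_n) :
  gaussian_vector P S V -> entrywise (sqint P) V.
Proof.
move=> gV j; have [v v0 law] := gaussian_vector_entry j gV.
case: gV => _ /(_ j) mV _; apply/sqintP; split=> //.
pose Z : Omega -> measurableTypeR R := fun w => V w j 0.
have mf : measurable_fun setT (fun x : measurableTypeR R => (x ^+ 2)%:E).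
  by apply/measurable_EFinP; exact: measurable_funX.
rewrite [ltLHS](_ : _ = \int[pushforward P Z]_x (x ^+ 2)%:E)%E; last first.
  by rewrite ge0_integral_pushforward// => x _; rewrite lee_fin sqr_ge0.
have [v_eq0|vn0] := eqVneq v 0.
  rewrite (eq_measure_integral (\d_(0 : measurableTypeR R))) => [|B mB _].
    by rewrite integral_dirac// diracT mul1e expr0n/= ltry.
  by rewrite [LHS](law B)// /normal_law v_eq0 eqxx.
have s0 : Num.sqrt v != 0 by rewrite sqrtr_eq0 -ltNge lt_def vn0.
rewrite (_ : (\int[_]_x _)%E = (\int[normal_prob 0 (Num.sqrt v)]_x (x ^+ 2)%:E)%E).
  exact: integral_sqr_normal_prob_lty.
apply: eq_measure_integral => B mB _.
by rewrite [LHS](law B)// /normal_law (negbTE vn0).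
Qed.

(** A pi-system argument: the finite measures sending [A] to [P (A & D)] and to [P D * P A] agree on
    the intersections of events of the [F i], [i] in [K], and these are stable under intersection
    and generate the joint sigma-algebra. *)
Lemma mutually_independent_sub (I : finType) (F : I -> set (set Omega))
    (K : {pred I}) (j : I) (A D : set Omega) :
  mutually_independent P F ->
  (forall i, i \in K -> sigma_algebra setT (F i) /\ F i `<=` measurable) ->
  F j `<=` measurable -> j \notin K ->
  <<s \bigcup_(i in [set` K]) F i >> A -> F j D ->
  P (A `&` D) = (P A * P D)%E.
Proof.
move=> indF sF mF jK.
pose C := [set A | exists2 E : I -> set Omega, (forall i, i \in K -> F i (E i)) &
  A = \bigcap_(i in [set` enum K]) E i].
have FT i : i \in K -> F i setT.
  by move=> /sF[[F0 FC _] _]; rewrite -(setD0 setT); exact: FC.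
have mC : C `<=` measurable.
  move=> _ [E FE ->]; apply: fin_bigcap_measurable => //.
  by move=> i /=; rewrite mem_enum => iK; apply: (sF i iK).2; exact: FE.
have CI : setI_closed C.
  move=> _ _ [E FE ->] [E' FE' ->]; exists (fun i => E i `&` E' i).
    move=> i iK; have [sFi _] := sF i iK; rewrite -(sigma_algebra_id sFi).
    by apply: (@measurableI _ (g_sigma_algebraType (F i)));
      apply: sub_sigma_algebra; [exact: FE|exact: FE'].
  by rewrite bigcapI.
have gen : \bigcup_(i in [set` K]) F i `<=` C.
  move=> B [i /= iK FB]; exists (fun k => if k == i then B else setT).
    by move=> k kK; case: eqP => [->//|_]; exact: FT.
  apply/seteqP; split=> [w Bw k _|w Hw]; first by case: ifP.
  by have := Hw i; rewrite /= mem_enum eqxx; exact.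
move=> sA FD.
have mD : measurable D by exact: mF.
have r0 : (0 <= fine (P D)) by rewrite fine_ge0.
have : mrestr P mD A = mscale (NngNum r0) P A.
  apply: (g_sigma_algebra_measure_unique C mC (fun=> setT)) => //.
  - by move=> _; exists (fun=> setT) => //; rewrite bigcapT.
  - by rewrite bigcup_const//; exists 0%N.
  - move=> _ [E FE ->]; rewrite /mrestr/= /mscale/= fineK ?fin_num_measure//.
    (* Putting [D] at index [j] turns independence over [j :: enum K] into the required product; as
       [j] is outside [K], the events indexed by [K] do not change. *)
    pose E' k := if k == j then D else E k.
    have E'j : E' j = D by rewrite /E' eqxx.
    have E'K k : k \in enum K -> E' k = E k.
      by rewrite mem_enum /E' => kK; case: eqP jK => [<-|//]; rewrite kK.
    have capE : \bigcap_(i in [set` enum K]) E i = \bigcap_(i in [set` enum K]) E' i.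
      by apply: eq_bigcapr => k /= kK; rewrite E'K.
    have consE : [set` j :: enum K] = j |` [set` enum K].
      apply/seteqP; split=> k /=; rewrite inE => /predU1P; first exact.
      exact.
    have := indF (j :: enum K) E'; rewrite /= enum_uniq mem_enum jK.
    rewrite big_cons -(indF _ E') ?enum_uniq//; last first.
      by move=> k kK; rewrite E'K//; apply: FE; rewrite -mem_enum.
    rewrite E'j -capE => <- //.
      by congr (P _); rewrite consE bigcap_setU1 E'j setIC capE.
    move=> k; rewrite inE => /predU1P[->|kK]; first by rewrite E'j.
    by rewrite E'K//; apply: FE; rewrite -mem_enum.
  - by move=> k; rewrite /= /mrestr setTI -ge0_fin_numE ?fin_num_measure.
  - exact: sub_sigma_algebra2 gen _ sA.
rewrite /mrestr /mscale/= fineK ?fin_num_measure// => ->.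
by rewrite muleC.
Qed.

End independence.

(** * Optimality of the scheme *)

Section information.
Context (R : realType) d (Omega : measurableType d) (P : probability Omega R).

Lemma sigma_vec_coord n (V : Omega -> 'cV[R]_n) j (B : set R) :
  measurable B -> sigma_vec V ((fun w => V w j 0) @^-1` B).
Proof.
move=> mB; apply: sub_sigma_algebra; rewrite (bigD1 j)//=; left.
by exists B => //; rewrite setTI.
Qed.

Lemma sigma_vec_measurable n (V : Omega -> 'cV[R]_n) :
  (forall j, measurable_fun setT (fun w => V w j 0)) ->
  sigma_vec V `<=` measurable.
Proof.
move=> mV; apply: smallest_sub; first exact: sigma_algebra_measurable.
apply: (big_ind (fun S => S `<=` measurable)) =>
  [//|A B mA mB C [/mA|/mB]//|j _ _ [B mB <-]].
exact: mV.
Qed.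

Context (M : nat) (G : lqg_system R M) (T : nat).
Variables (Sigma0 : forall i : 'I_M, 'M[R]_(sdim G i))
  (Pcov : forall i : 'I_M, nat -> 'M[R]_(sdim G i))
  (X0 : forall i : 'I_M, Omega -> 'cV[R]_(sdim G i))
  (N : forall i : 'I_M, nat -> Omega -> 'cV[R]_(sdim G i)).
Hypothesis hX0 : forall i, gaussian_vector P (Sigma0 i) (X0 i).
Hypothesis hN : forall i t, (t < T)%N -> gaussian_vector P (Pcov i t) (N i t).
Hypothesis hind : mutually_independent P (primitive_sigma (T := T) X0 N).

Lemma primitive_sigma_algebra k :
  sigma_algebra setT (primitive_sigma (T := T) X0 N k).
Proof. by case: k => [i|[i r]] /=; exact: smallest_sigma_algebra. Qed.

Lemma primitive_sigma_measurable k :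
  primitive_sigma (T := T) X0 N k `<=` measurable.
Proof.
case: k => [i|[i r]] /=; apply: sigma_vec_measurable => j.
  by case: (hX0 i).
by case: (hN i (ltn_ord r)).
Qed.

(** The primitive variables known at time [t]: all initial states, and the noises at times strictly
    before [t]. *)
Definition before t : {pred 'I_M + 'I_M * 'I_T} :=
  fun k => if k is inr (_, r) then (r < t)%N else true.

Lemma filtration_primitive t : (t <= T)%N -> filtration X0 N t `<=`
  <<s \bigcup_(k in [set` before t]) primitive_sigma (T := T) X0 N k >>.
Proof.
move=> tT; apply: sub_sigma_algebra2 => A [[i _ iA]|[i _ [r rt iA]]].
  by exists (inl i).
by exists (inr (i, Ordinal (leq_trans rt tT))).
Qed.

Lemma filtration_measurable t : (t <= T)%N -> filtration X0 N t `<=` measurable.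
Proof.
move=> /filtration_primitive sub A /sub; apply: smallest_sub.
  exact: sigma_algebra_measurable.
by move=> B [k _]; exact: primitive_sigma_measurable.
Qed.

Lemma filtrationS t : filtration X0 N t `<=` filtration X0 N t.+1.
Proof.
apply: sub_sigma_algebra2 => A [[i _ iA]|[i _ [r rt iA]]].
  by left; exists i.
by right; exists i => //; exists r => //; exact: ltnW.
Qed.

Definition past t (f : Omega -> R) : Prop :=
  sqint P f /\ forall B : set R, measurable B -> filtration X0 N t (f @^-1` B).

(** Orthogonality in L^2 to the past, a consequence of independence and symmetry that is closed
    under linear combinations. *)
Definition innovation t (g : Omega -> R) : Prop :=
  sqint P g /\ forall f, past t f -> \int[P]_w (f w * g w) = 0.

Lemma linear_class_past t : linear_class (past t).
Proof.
have [sq0 sqD] := linear_class_sqint P.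
split.
  split=> // B mB; rewrite preimage_cst; case: ifP => _.
    exact: (@measurableT _ (g_sigma_algebraType _)).
  exact: sigma_algebra0.
move=> a f g [f2 mf] [g2 mg]; split; first exact: sqD.
rewrite /filtration in mf mg *; set gen := (X in <<s X >>) in mf mg *.
(* The functions are retyped on the space carrying the filtration as its sigma-algebra, where sums
   and products of measurable functions are available. *)
pose f' : g_sigma_algebraType gen -> R := f.
pose g' : g_sigma_algebraType gen -> R := g.
have mf' : measurable_fun setT f' by move=> _ B mB; rewrite setTI; exact: mf.
have mg' : measurable_fun setT g' by move=> _ B mB; rewrite setTI; exact: mg.
move=> B mB; have : measurable_fun setT (fun w => a * f' w + g' w).
  by apply: measurable_funD => //; exact: measurable_funM.
by move=> /(_ measurableT B mB); rewrite setTI.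
Qed.

Lemma linear_class_innovation t : linear_class (innovation t).
Proof.
have [sq0 sqD] := linear_class_sqint P.
split.
  split=> // f [f2 _]; rewrite -[RHS](mul0r (fine (P setT))) -Rintegral_cst//.
  by apply: eq_Rintegral => w _; rewrite mulr0.
move=> a g h [g2 Hg] [h2 Hh]; split; first exact: sqD.
move=> f fp; have [f2 _] := fp.
transitivity (\int[P]_w (a * (f w * g w) + f w * h w)).
  by apply: eq_Rintegral => w _; rewrite mulrDr mulrCA.
rewrite RintegralD//; [|exact/integrZ/integrM|exact: integrM].
by rewrite RintegralZl//; [rewrite Hg// Hh// mulr0 addr0|exact: integrM].
Qed.

Lemma pastS t f : past t f -> past t.+1 f.
Proof. by case=> f2 mf; split=> // B /mf; exact: filtrationS. Qed.

Lemma past_initial t i : entrywise (past t) (X0 i).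
Proof.
move=> j; split; first exact: gaussian_vector_sqint (hX0 i) j.
move=> B mB; apply: sub_sigma_algebra; left; exists i => //.
exact: sigma_vec_coord.
Qed.

Lemma past_noise t r i : (r < t)%N -> (r < T)%N -> entrywise (past t) (N i r).
Proof.
move=> rt rT j; split; first exact: gaussian_vector_sqint (hN i rT) j.
move=> B mB; apply: sub_sigma_algebra; right; exists i => //; exists r => //.
exact: sigma_vec_coord.
Qed.

(** The noise at time [t] is independent of the primitive variables that generate the filtration at
    [t], and its entries have symmetric laws. *)
Lemma innovation_noise t i : (t < T)%N -> entrywise (innovation t) (N i t).
Proof.
move=> tT j; have Z2 := gaussian_vector_sqint (hN i tT) j.
split=> // f [f2 mf]; apply: Rintegral_mul_symmetric => // [A B mA mB|B mB].
  apply: (mutually_independent_sub (K := before t) (j := inr (i, Ordinal tT)) hind).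
  - move=> k _; split; first exact: primitive_sigma_algebra.
    exact: primitive_sigma_measurable.
  - exact: primitive_sigma_measurable.
  - by rewrite unfold_in /= ltnn.
  - by apply: filtration_primitive; [exact: ltnW|exact: mf].
  - exact: sigma_vec_coord.
exact: gaussian_vector_symmetric (hN i tT) mB.
Qed.

End information.

(** * Measurability and integrability along random states *)

Section random_controls.
Context (R : realType) d (Omega : measurableType d) (P : probability Omega R).
Context (M : nat) (G : lqg_system R M).
Local Notation state := (forall i : 'I_M, Omega -> 'cV[R]_(sdim G i)).

Section linear_class.
Variables (K : (Omega -> R) -> Prop) (hK : linear_class K).

Lemma entrywise_plan n (Y : state) i : (forall j, entrywise K (Y j)) ->
  entrywise K (fun w => plan n (fun j => Y j w) i).
Proof.
move=> KY; apply: entrywiseN => //; apply: entrywise_mul => //.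
apply: entrywiseD => //; first exact: entrywise_mul.
apply: entrywiseZ => //; apply: entrywiseN => //; apply: entrywise_mul => //.
apply: entrywise_sum => // j.
by apply: entrywise_mul => //; exact: entrywise_mul.
Qed.

Lemma entrywise_plan_traj n (Y : state) i t :
  (forall j, entrywise K (Y j)) ->
  entrywise K (fun w => plan_traj n (fun j => Y j w) i t).
Proof.
move=> KY; apply: entrywiseD => //; apply: entrywise_mul => //.
exact: entrywise_plan.
Qed.

Lemma seq_of_plan_class n (Y : state) i t : (forall j, entrywise K (Y j)) ->
  K (fun w => seq_of_col (plan n (fun j => Y j w) i) t).
Proof.
move=> KY; have Kplan : entrywise K (fun w => plan n (fun j => Y j w) i).
  exact: entrywise_plan.
exact: (entrywise_mul hK (pick_row R n t) Kplan).
Qed.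

End linear_class.

Lemma integr_stage_cost i (X : Omega -> 'cV[R]_(sdim G i)) (U : Omega -> R) :
  entrywise (sqint P) X -> sqint P U ->
  integr P (fun w => stage_cost (X w) (U w)).
Proof.
move=> X2 U2; apply: integrD; last by apply: integrZ; exact: integrM.
have := integr_dot X2 (entrywise_mul (linear_class_sqint P) (matQ G i) X2).
by congr integr; apply/funext => w; rewrite quadE.
Qed.

Lemma linear_class_measurable :
  linear_class (fun f : Omega -> R => measurable_fun setT f).
Proof.
split=> [|a f g mf mg]; first exact: measurable_cst.
by apply: measurable_funD => //; exact: measurable_funM.
Qed.

Lemma measurable_stage_cost i (X : Omega -> 'cV[R]_(sdim G i)) (U : Omega -> R) :
  entrywise (measurable_fun setT) X -> measurable_fun setT U ->
  measurable_fun setT (fun w => stage_cost (X w) (U w)).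
Proof.
move=> mX mU; apply: measurable_funD; last first.
  by apply: measurable_funM => //; exact: measurable_funX.
have mQX := entrywise_mul linear_class_measurable (matQ G i) mX.
rewrite (_ : (fun w => _) = fun w => \sum_k X w k 0 * (matQ G i *m X w) k 0).
  by apply: measurable_sum => k; apply: measurable_funM; [exact: mX|exact: mQX].
by apply/funext => w; rewrite quadE dotE.
Qed.

Lemma integr_sum (I : Type) (s : seq I) (F : I -> Omega -> R) :
  (forall i, integr P (F i)) -> integr P (fun w => \sum_(i <- s) F i w).
Proof. exact: (linear_class_sum (linear_class_integr P)). Qed.

Lemma integr_value n (Y : state) : (forall i, entrywise (sqint P) (Y i)) ->
  integr P (fun w => value n (fun i => Y i w)).
Proof.
move=> Y2; have sq := linear_class_sqint P.
apply: integr_sum => i; apply: integr_sum => t.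
apply: integr_stage_cost; last exact: seq_of_plan_class.
have := @entrywise_plan_traj _ sq n Y i t Y2; congr entrywise.
by apply/funext => w; rewrite traj_col.
Qed.

Definition centered (f : Omega -> R) : Prop := integr P f /\ \int[P]_w f w = 0.

Lemma linear_class_centered : linear_class centered.
Proof.
have [int0 intD] := linear_class_integr P; split.
  split=> //; rewrite -[RHS](mul0r (fine (P setT))) -Rintegral_cst//.
move=> a f g [f1 f0] [g1 g0]; split; first exact: intD.
rewrite RintegralD//; last exact: integrZ.
by rewrite RintegralZl// f0 g0 mulr0 addr0.
Qed.

End random_controls.

(** * Lower bound for admissible controls and its attainment *)

Section optimality.
Context (R : realType) d (Omega : measurableType d) (P : probability Omega R).
Context (M : nat) (G : lqg_system R M) (T : nat).
Variables (Sigma0 : forall i : 'I_M, 'M[R]_(sdim G i))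
  (Pcov : forall i : 'I_M, nat -> 'M[R]_(sdim G i))
  (X0 : forall i : 'I_M, Omega -> 'cV[R]_(sdim G i))
  (N : forall i : 'I_M, nat -> Omega -> 'cV[R]_(sdim G i)).
Hypothesis hQ : forall i, psd (matQ G i).
Hypothesis hR : forall i, 0 < wgtR G i.
Hypothesis hX0 : forall i, gaussian_vector P (Sigma0 i) (X0 i).
Hypothesis hN : forall i t, (t < T)%N -> gaussian_vector P (Pcov i t) (N i t).
Hypothesis hind : mutually_independent P (primitive_sigma (T := T) X0 N).
Local Notation past := (past P X0 N).
Local Notation innovation := (innovation P X0 N).

(** Plans preserve linear classes, so the polar form is a linear combination of products of a past
    variable and an innovation, each of mean 0. *)
Lemma centered_value_polar n t (Y Z : forall i, Omega -> 'cV[R]_(sdim G i)) :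
  (forall i, entrywise (past t) (Y i)) ->
  (forall i, entrywise (innovation t) (Z i)) ->
  centered P (fun w => value_polar n (fun i => Y i w) (fun i => Z i w)).
Proof.
move=> Yp Zi; have cen := linear_class_centered P.
have lp := linear_class_past P X0 N t; have li := linear_class_innovation P X0 N t.
have prod f g : past t f -> innovation t g -> centered P (fun w => f w * g w).
  by move=> fp [g2 g0]; split; [apply: integrM => //; case: fp|exact: g0].
apply: (linear_class_sum cen) => i; apply: (linear_class_sum cen) => r.
apply: (linear_classD cen); last first.
  apply: (linear_classZ cen); apply: prod.
    exact: seq_of_plan_class.
  exact: seq_of_plan_class.
have pY := entrywise_mul lp (matQ G i)
  (@entrywise_plan_traj _ _ _ _ _ _ lp n Y i r Yp).
have pZ := @entrywise_plan_traj _ _ _ _ _ _ li n Z i r Zi.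
have := linear_class_sum cen (index_enum _) (fun k => prod _ _ (pY k) (pZ k)).
by congr centered; apply/funext => w; rewrite dotC dotE.
Qed.

Lemma Rintegral_valueD n t (Y Z : forall i, Omega -> 'cV[R]_(sdim G i)) :
  (forall i, entrywise (past t) (Y i)) ->
  (forall i, entrywise (innovation t) (Z i)) ->
  \int[P]_w value n (fun i => Y i w + Z i w) =
  \int[P]_w value n (fun i => Y i w) + \int[P]_w value n (fun i => Z i w).
Proof.
move=> Yp Zi; have [polar1 polar0] := centered_value_polar n Yp Zi.
have Y1 : integr P (fun w => value n (fun i => Y i w)).
  by apply: integr_value => i j; case: (Yp i j).
have Z1 : integr P (fun w => value n (fun i => Z i w)).
  by apply: integr_value => i j; case: (Zi i j).
transitivity (\int[P]_w (value n (fun i => Y i w) +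
    2 * value_polar n (fun i => Y i w) (fun i => Z i w) +
    value n (fun i => Z i w))).
  by apply: eq_Rintegral => w _; rewrite valueD.
apply: etrans (Rintegral_linear3 2 Y1 polar1 Z1) _.
by rewrite [X in _ + 2 * X + _]polar0 mulr0 addr0.
Qed.

(** The class may depend on time, and the hypothesis on [U] may use the states at the same time;
    this covers feedback controls as well as given ones. *)
Lemma entrywise_dynamics (K : nat -> (Omega -> R) -> Prop) X U :
  (forall t, linear_class (K t)) -> (forall t f, K t f -> K t.+1 f) ->
  (forall i, entrywise (K 0%N) (X0 i)) ->
  (forall i t, (t < T)%N -> entrywise (K t.+1) (N i t)) ->
  (forall i t, (t < T)%N -> (forall j, entrywise (K t) (X j t)) -> K t (U i t)) ->
  dynamics T X0 N X U ->
  forall t i, (t <= T)%N -> entrywise (K t) (X i t).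
Proof.
move=> lK KS KX0 KN KU [XX0 XS]; elim=> [|t IH] i tT.
  by rewrite (_ : X i 0%N = X0 i) //; apply/funext => w; exact: XX0.
rewrite (_ : X i t.+1 =
    fun w => (matA G i *m X i t w + U i t w *: matB G i) + N i t w).
  apply: entrywiseD => //; last exact: KN.
  apply: entrywiseD => //.
    apply: entrywise_mul => // j; apply: KS.
    exact: IH (ltnW tT) j.
  move=> j; have := linear_classZ (lK t.+1) (matB G i j 0) 
    (KS _ _ (KU i t tT (fun k => IH k (ltnW tT)))).
  by congr K; apply/funext => w; rewrite mxE mulrC.
by apply/funext => w; rewrite XS.
Qed.

Definition running_cost (X : forall i : 'I_M, nat -> Omega -> 'cV[R]_(sdim G i))
    U t w : R := \sum_(i < M) stage_cost (X i t w) (U i t w).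

(** The noise entering at time [t] is charged the value over the [T - t - 1] steps that remain after
    it. *)
Definition optimal_cost : R := \int[P]_w value T (fun i => X0 i w) +
  \sum_(t < T) \int[P]_w value (T - t.+1) (fun i => N i t w).

Section past_control.
Variables (X : forall i : 'I_M, nat -> Omega -> 'cV[R]_(sdim G i))
  (U : 'I_M -> nat -> Omega -> R).
Hypothesis XU : dynamics T X0 N X U.
Hypothesis pU : forall i t, (t < T)%N -> past t (U i t).

Lemma past_state t i : (t <= T)%N -> entrywise (past t) (X i t).
Proof.
apply: (entrywise_dynamics _ _ _ _ _ XU) => {t i}.
- exact: linear_class_past.
- exact: pastS.
- exact: past_initial hX0 _.
- by move=> i t tT; exact: (@past_noise _ _ _ _ _ _ T Pcov X0 N hN t.+1 t i).
- by move=> i t tT _; exact: pU.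
Qed.

Lemma integr_running_cost t : (t < T)%N -> integr P (running_cost X U t).
Proof.
move=> tT; apply: integr_sum => i; apply: integr_stage_cost.
  by move=> j; case: (past_state (ltnW tT) j).
by case: (pU i tT).
Qed.

Let mean_value t := \int[P]_w value (T - t) (fun i => X i t w).

Let noise_value t := \int[P]_w value (T - t.+1) (fun i => N i t w).

(** Telescoping: the initial term is the mean value at [X0], and the final one vanishes with no step
    left. *)
Lemma sum_mean_value : optimal_cost =
  \sum_(t < T) (mean_value t - mean_value t.+1 + noise_value t).
Proof.
rewrite big_split/= -(big_mkord xpredT (fun t => mean_value t - mean_value t.+1)).
rewrite (@telescope_sumr_eq _ _ _ (fun t => - mean_value t))//; last first.
  by move=> k _; rewrite opprK addrC.
rewrite /optimal_cost; congr (_ + _).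
rewrite opprK /mean_value subn0 subnn [X in - X](_ : _ = 0); last first.
  rewrite -[RHS](mul0r (fine (P setT))) -Rintegral_cst//.
  by apply: eq_Rintegral => w _; rewrite value0.
rewrite oppr0 add0r; apply: eq_Rintegral => w _; congr value.
by apply: functional_extensionality_dep => i; case: XU.
Qed.

Lemma past_step t i : (t < T)%N ->
  entrywise (past t) (fun w => step (X i t w) (U i t w)).
Proof.
move=> tT; have lp := linear_class_past P X0 N t.
apply: entrywiseD => //.
  by apply: entrywise_mul => //; exact: past_state (ltnW tT).
move=> j; have := linear_classZ lp (matB G i j 0) (pU i tT).
by congr past; apply/funext => w; rewrite mxE mulrC.
Qed.

Lemma mean_value_step t : (t < T)%N -> mean_value t.+1 =
  \int[P]_w value (T - t.+1) (fun i => step (X i t w) (U i t w)) +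
  noise_value t.
Proof.
move=> tT; case: XU => _ XS.
rewrite -(@Rintegral_valueD _ t) => [|i|i].
- apply: eq_Rintegral => w _; congr value.
  by apply: functional_extensionality_dep => i; rewrite XS.
- exact: past_step.
- exact: (innovation_noise hX0 hN hind).
Qed.

Lemma integr_step_value n t : (t < T)%N ->
  integr P (fun w => value n (fun i => step (X i t w) (U i t w))).
Proof.
by move=> tT; apply: integr_value => i j; case: (past_step tT j).
Qed.

Lemma integr_state_value n t : (t <= T)%N ->
  integr P (fun w => value n (fun i => X i t w)).
Proof.
by move=> tT; apply: integr_value => i j; case: (past_state tT j).
Qed.

Lemma Rintegral_total_cost :
  \int[P]_w (\sum_(0 <= t < T) running_cost X U t w) =
  \sum_(t < T) \int[P]_w running_cost X U t w.
Proof.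
transitivity (\int[P]_w (\sum_(t < T) running_cost X U t w)).
  by apply: eq_Rintegral => w _; rewrite big_mkord.
by rewrite Rintegral_sum// => t; exact: integr_running_cost.
Qed.

Lemma integr_total_cost :
  integr P (fun w => \sum_(0 <= t < T) running_cost X U t w).
Proof.
have := integr_sum (index_enum _) (fun t : 'I_T => integr_running_cost (ltn_ord t)).
by congr integr; apply/funext => w; rewrite big_mkord.
Qed.

(** In each summand the noise term cancels against the one in [mean_value_step]; what remains is the
    Bellman inequality integrated over outcomes. *)
Lemma optimal_cost_le :
  (forall t w, (t < T)%N -> \sum_(i < M) U i t w = 0) ->
  optimal_cost <= \int[P]_w (\sum_(0 <= t < T) running_cost X U t w).
Proof.
move=> bal; rewrite sum_mean_value Rintegral_total_cost; apply: ler_sum => t _.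
have tT := ltn_ord t; rewrite mean_value_step// opprD addrA subrK lerBlDr.
rewrite -RintegralD//; [|exact: integr_running_cost|exact: integr_step_value].
apply: le_Rintegral => //.
- exact/integr_state_value/ltnW.
- by apply: integrD; [exact: integr_running_cost|exact: integr_step_value].
- by move=> w _; rewrite -(subnSK tT) value_bellman_le// bal.
Qed.

Lemma optimal_cost_eq :
  (forall i t w, (t < T)%N ->
     U i t w = seq_of_col (plan (T - t) (fun j => X j t w) i) 0) ->
  optimal_cost = \int[P]_w (\sum_(0 <= t < T) running_cost X U t w).
Proof.
move=> UE; rewrite sum_mean_value Rintegral_total_cost; apply: eq_bigr => t _.
have tT := ltn_ord t; rewrite mean_value_step// opprD addrA subrK.
apply/eqP; rewrite subr_eq; apply/eqP.
rewrite -RintegralD//; [|exact: integr_running_cost|exact: integr_step_value].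
apply: eq_Rintegral => w _.
have vE i : seq_of_col (plan (T - t.+1).+1 (fun j => X j t w) i) 0 = U i t w.
  by rewrite UE// -(subnSK tT).
rewrite -(subnSK tT) (value_bellman hQ hR (T - t.+1) (fun i => X i t w)).
apply: (congr2 +%R); first by apply: eq_bigr => i _; rewrite vE.
apply: (congr1 (value (T - t.+1))).
by apply: functional_extensionality_dep => i; rewrite vE.
Qed.

End past_control.

Lemma stage_cost_ge0 i (x : 'cV[R]_(sdim G i)) u : 0 <= stage_cost x u.
Proof. by rewrite addr_ge0 ?(hQ i).2// mulr_ge0 ?sqr_ge0// ltW. Qed.

Lemma running_cost_ge0 X U t w : 0 <= running_cost X U t w.
Proof. by apply: sumr_ge0 => i _; exact: stage_cost_ge0. Qed.

Lemma total_cost_ge0 X U w : 0 <= \sum_(0 <= t < T) running_cost X U t w.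
Proof. by apply: sumr_ge0 => t _; exact: running_cost_ge0. Qed.

Lemma control_cost_le X U i t w : (t < T)%N ->
  wgtR G i * U i t w ^+ 2 <= \sum_(0 <= t < T) running_cost X U t w.
Proof.
move=> tT; rewrite big_mkord (bigD1 (Ordinal tT))//= ler_wpDr//.
  by apply: sumr_ge0 => r _; exact: running_cost_ge0.
rewrite /running_cost (bigD1 i)//= ler_wpDr//.
  by apply: sumr_ge0 => j _; exact: stage_cost_ge0.
by rewrite lerDr (hQ i).2.
Qed.

(** Since [wgtR G i > 0], the total cost dominates a positive multiple of each squared action, so
    finite cost supplies the square-integrability that adaptedness does not give. *)
Lemma past_of_finite_cost X U : feasible T X0 N X U ->
  (expected_cost P T X U < +oo)%E ->
  forall i t, (t < T)%N -> past t (U i t).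
Proof.
case=> XU _ aU; rewrite /expected_cost unlock => Joo i t tT.
split; last by move=> B mB; exact: aU.
have mU j r : (r < T)%N -> measurable_fun setT (U j r).
  move=> rT _ B mB; rewrite setTI; apply: (filtration_measurable hX0 hN (ltnW rT)).
  exact: aU.
have mX j r : (r <= T)%N -> entrywise (measurable_fun setT) (X j r).
  apply: (@entrywise_dynamics (fun=> measurable_fun setT) X U _ _ _ _ _ XU) => //.
  - by move=> _; exact: linear_class_measurable.
  - by move=> k l; case: (hX0 k).
  - by move=> k r' r'T l; case: (hN k r'T).
  - by move=> k r' r'T _; exact: mU.
apply/sqintP; split; first exact: mU.
have mC : measurable_fun setT (fun w => \sum_(0 <= r < T) running_cost X U r w).
  rewrite (_ : (fun w => _) = fun w => \sum_(r < T) running_cost X U r w); last first.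
    by apply/funext => w; rewrite big_mkord.
  apply: measurable_sum => r; apply: measurable_sum => j.
  apply: measurable_stage_cost; last exact: mU.
  exact/mX/ltnW.
set J := (\int[P]_w _)%E in Joo.
apply: (@le_lt_trans _ _ ((wgtR G i)^-1%:E * J)%E); last first.
  by rewrite lte_mul_pinfty// lee_fin invr_ge0 ltW.
rewrite -ge0_integralZl//; last 3 first.
- exact/measurable_EFinP.
- by move=> w _; rewrite lee_fin; exact: total_cost_ge0.
- by rewrite lee_fin invr_ge0 ltW.
apply: ge0_le_integral => //.
- by move=> w _; rewrite lee_fin sqr_ge0.
- by apply/measurable_EFinP; apply: measurable_funX; exact: mU.
- by apply: measurable_funeM; exact/measurable_EFinP.
- move=> w _; rewrite -EFinM lee_fin ler_pdivlMl//.
  exact: control_cost_le.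
Qed.

(** * Runs of the bid-price scheme *)

Section run.
Variables (alpha : nat -> R) (lam0 : nat -> Omega -> nat -> R).
Hypothesis halpha : step_sizes alpha.

Lemma run_cvg lam u X U : bid_price_run T X0 N alpha lam0 lam u X U ->
  forall s w i t, (s <= t < T)%N -> u s w k i t @[k --> \oo] -->
    seq_of_col (plan (T - s) (fun j => X j s w) i) (t - s).
Proof.
case=> _ it _ s w i t /andP[st tT]; have sT := leq_ltn_trans st tT.
have := it s w sT; rewrite -{1}(subnKC (ltnW sT)).
move=> /(price_iteration_cvg hQ hR halpha) /(_ i (t - s)%N).
by rewrite subnKC//; apply; rewrite ltn_sub2r.
Qed.

Lemma run_control lam u X U : bid_price_run T X0 N alpha lam0 lam u X U ->
  forall i t w, (t < T)%N ->
  U i t w = seq_of_col (plan (T - t) (fun j => X j t w) i) 0.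
Proof.
move=> run i t w tT; have [_ _ ->//] := run.
have tt : (t <= t < T)%N by rewrite leqnn.
have := @run_cvg lam u X U run t w i t tt; rewrite subnn.
exact: cvg_lim.
Qed.

(** The limits of the bids are known in advance, so the states are first built in closed loop with
    the first action of [plan]; then prices and bids are chosen for each time and outcome. *)
Lemma run_exists : exists lam u X U, bid_price_run T X0 N alpha lam0 lam u X U.
Proof.
pose act t (x : forall i, 'cV[R]_(sdim G i)) i : R :=
  seq_of_col (plan (T - t) x i) 0.
pose X' w := fix X' t : forall i, 'cV[R]_(sdim G i) := if t is t'.+1 then
  fun i => step (X' t' i) (act t' (X' t') i) + N i t' w else fun i => X0 i w.
pose X i t w := X' w t i.
have /choice[f Hf] : forall sw : nat * Omega,
    exists lu : (nat -> nat -> R) * (nat -> 'I_M -> nat -> R),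
    (sw.1 < T)%N -> price_iteration sw.1 T (fun i => X i sw.1 sw.2) alpha
      (lam0 sw.1 sw.2) lu.1 lu.2.
  move=> [s w] /=; have [sT|_] := ltnP s T; last by exists (fun _ _ => 0, fun _ _ _ => 0).
  have [lam [u H]] := price_iteration_exists hQ hR alpha s (T - s)
    (fun i => X i s w) (lam0 s w).
  by exists (lam, u) => _ /=; rewrite -{1}(subnKC (ltnW sT)).
pose lam s w := (f (s, w)).1; pose u s w := (f (s, w)).2.
have it s w : (s < T)%N -> price_iteration s T (fun i => X i s w) alpha
    (lam0 s w) (lam s w) (u s w) by exact: (Hf (s, w)).
exists lam, u, X, (fun i t w => act t (fun j => X j t w) i); split=> //.
move=> i s w sT; apply/esym/cvg_lim => //.
have := it s w sT; rewrite -{1}(subnKC (ltnW sT)).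
move=> /(price_iteration_cvg hQ hR halpha) /(_ i 0%N).
by rewrite addn0; apply; rewrite subn_gt0.
Qed.

(** The action is a linear function of the current states, so measurability and square-integrability
    propagate in time together with the states. *)
Lemma run_past lam u X U : bid_price_run T X0 N alpha lam0 lam u X U ->
  forall i t, (t < T)%N -> past t (U i t).
Proof.
move=> run i t tT; have [XU _ _] := run.
have pU j r : (r < T)%N -> (forall k, entrywise (past r) (X k r)) -> past r (U j r).
  move=> rT pX; have lp := linear_class_past P X0 N r.
  have := @seq_of_plan_class _ _ _ _ _ _ lp (T - r) (fun k => X k r) j 0 pX.
  by congr past; apply/funext => w; rewrite (run_control run).
apply: (pU) => // j; apply: (entrywise_dynamics _ _ _ _ pU XU); last exact: ltnW.
- exact: linear_class_past.
- exact: pastS.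
- exact: past_initial hX0 _.
- by move=> k r rT; exact: (@past_noise _ _ _ _ _ _ T Pcov X0 N hN r.+1 r k).
Qed.

Lemma run_feasible lam u X U : bid_price_run T X0 N alpha lam0 lam u X U ->
  feasible T X0 N X U.
Proof.
move=> run; have [XU _ _] := run; split=> // [t w tT|i t B tT mB].
  under eq_bigr => i _ do rewrite (run_control run)//.
  by rewrite /seq_of_col -summxE -mulmx_sumr plan_balanced// mulmx0 mxE.
by case: (run_past run i tT) => _; exact.
Qed.

Lemma expected_cost_past X U : dynamics T X0 N X U ->
  (forall i t, (t < T)%N -> past t (U i t)) ->
  expected_cost P T X U =
  (\int[P]_w (\sum_(0 <= t < T) running_cost X U t w))%:E.
Proof.
move=> XU pU; rewrite /expected_cost unlock /Rintegral fineK//.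
exact: integrable_fin_num (integr_total_cost XU pU).
Qed.

Lemma run_optimal lam u X U : bid_price_run T X0 N alpha lam0 lam u X U ->
  expected_cost P T X U = min_expected_cost P T X0 N.
Proof.
move=> run; have [XU _ _] := run; apply/eqP; rewrite eq_le; apply/andP; split.
  rewrite (expected_cost_past XU (run_past run)).
  rewrite -(optimal_cost_eq XU (run_past run) (run_control run)).
  apply: le_ereal_inf_tmp => _ [X' [U' [XU' ->]]].
  (* A competitor of infinite cost is trivially no better; one of finite cost has past controls and
     obeys the lower bound. *)
  have [->|] := eqVneq (expected_cost P T X' U') +oo%E; first exact: leey.
  rewrite -ltey => /(past_of_finite_cost XU') pU'; have [dXU' bal _] := XU'.
  rewrite (expected_cost_past dXU' pU') lee_fin.
  exact: (optimal_cost_le dXU' pU' bal).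
apply: ereal_inf_lbound; exists X, U; split=> //; exact: run_feasible run.
Qed.

End run.

End optimality.

(** Existence of a run keeps the second part from being vacuous; convergence of the bids is asserted
    separately because [lim] is defined even for divergent sequences. *)
Theorem theorem5 (R : realType) (d : measure_display) (Omega : measurableType d)
    (P : probability Omega R) (M : nat) (G : lqg_system R M) (T : nat)
    (Sigma0 : forall i : 'I_M, 'M[R]_(sdim G i))
    (Pcov : forall i : 'I_M, nat -> 'M[R]_(sdim G i))
    (X0 : forall i : 'I_M, Omega -> 'cV[R]_(sdim G i))
    (N : forall i : 'I_M, nat -> Omega -> 'cV[R]_(sdim G i))
    (alpha : nat -> R) (lam0 : nat -> Omega -> nat -> R)
    (hQ : forall i, psd (matQ G i))
    (hR : forall i, 0 < wgtR G i)
    (hX0 : forall i, gaussian_vector P (Sigma0 i) (X0 i))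
    (hN : forall i t, (t < T)%N -> gaussian_vector P (Pcov i t) (N i t))
    (hind : mutually_independent P (primitive_sigma (T := T) X0 N))
    (halpha : step_sizes alpha) :
  (exists lam u X U, bid_price_run T X0 N alpha lam0 lam u X U) /\
  (forall lam u X U, bid_price_run T X0 N alpha lam0 lam u X U ->
     [/\ forall s w i t, (s <= t < T)%N -> cvg (u s w k i t @[k --> \oo]),
         feasible T X0 N X U &
         expected_cost P T X U = min_expected_cost P T X0 N]).
Proof.
split=> [|lam u X U run]; first exact: run_exists.
split.
- move=> s w i t stT; apply/cvg_ex; eexists.
  exact: (run_cvg hQ hR halpha run stT).
- exact: (run_feasible hQ hR hX0 hN halpha run).
- exact: (run_optimal hQ hR hX0 hN hind halpha run).
Qed.
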